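(* For each $(\omega,\epsilon)\in D_n$, let $\widetilde\rho_{\omega,\epsilon}$ be the fundamental cycle of $\overline{\widetilde\Pi}_{\omega,\epsilon}$. Then $\{\widetilde\rho_{\omega,\epsilon}:(\omega,\epsilon)\in D_n,\ \omega(1)\ne n$ and all right-to-left maxima of $(\omega,\epsilon)$ are unbarred$\}$ is a basis for $\widetilde H_{n-2}(\overline{\Pi^D_n};\mathbb{Z})$.
   Context: $D_n$ is the set of signed permutations $(\omega,\epsilon)$ ($\omega\in S_n$, $\epsilon\in\{-1,1\}^n$, $\omega(i)$ barred iff $\epsilon_i=-1$) with an even number of bars; $\epsilon'$ is $\epsilon$ with $\epsilon_1$ negated. $\omega(i)$ is a right-to-left maximum if $\omega(i)>\omega(j)$ for all $j>i$. Signed partitions: partitions of $\{0,\dots,n\}$ in which nonminimal elements of nonzero blocks (blocks not containing $0$) may be barred; the zero block has no bars. $\bar b$ toggles all bars of a block $b$, $\widetilde b$ removes them. $\Pi^B_n$ is ordered by $\pi\le\tau$ iff for each block $b$ of $\pi$, $b$ or $\bar b$ lies (as signed letters) in a nonzero block of $\tau$, or $\widetilde b$ lies in the zero block of $\tau$. $\Pi^D_n$ is the subposet of signed partitions whose zero block does not have size 2; it has minimum $\hat0$ and maximum $\hat1$, and $\overline{\Pi^D_n}=\Pi^D_n\setminus\{\hat0,\hat1\}$; homology is that of the order complex. Splitting $(\omega,\epsilon)$ at positions $i_1<\dots<i_k$ in $\{0,\dots,n-1\}$ ($i_{k+1}=n$; $k=0$ gives the one-block partition): zero block $\{0,\omega(1),\dots,\omega(i_1)\}$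 and for $j=1,\dots,k$ the nonzero block equal to whichever of $b_j=\{(\omega(i_j+1),\epsilon_{i_j+1}),\dots,(\omega(i_{j+1}),\epsilon_{i_{j+1}})\}$ or $\bar b_j$ has unbarred minimal element (where $(a,-1)=\bar a$, $(a,1)=a$). $\widetilde\Pi_{\omega,\epsilon}$ is the induced subposet of $\Pi^D_n$ of all signed partitions obtained by splitting $(\omega,\epsilon)$ or $(\omega,\epsilon')$ at all positions of a subset of $\{0,\dots,n-1\}$ whose smallest element is not $1$; it is isomorphic to the lattice of subsets of $[n]$, so the order complex of its proper part $\overline{\widetilde\Pi}_{\omega,\epsilon}$ is an $(n-2)$-sphere, with fundamental cycle (defined up to sign) $\widetilde\rho_{\omega,\epsilon}$. *)

(* Defs.v *)
From HB Require Import structures.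
From mathcomp Require Import all_boot all_order all_fingroup all_algebra.
From mathcomp Require Import boolp.

Set Implicit Arguments.
Unset Strict Implicit.
Unset Printing Implicit Defensive.

Import Order.TTheory GRing.Theory.

Local Open Scope ring_scope.

(* Subposets of T are sets A : {set T} with the induced order.  A simplicial
   chain is an integer function on {set T}; a face of dimension k is a set of
   cardinality k.+1, and the empty face (dimension -1) belongs to the complex,
   so the homology below is reduced. *)
Section OrderComplex.
Context {d : Order.disp_t} {T : finPOrderType d}.
Implicit Types (A B : {set T}) (c : {ffun {set T} -> int}).

Definition proper_part A : {set T} :=
  [set x in A | ~~ [forall y in A, (x <= y)%O] && ~~ [forall y in A, (y <= x)%O]].

Lemma proper_partS A B : A \subset B -> proper_part A \subset proper_part B.
Proof.
move=> /subsetP sAB; apply/subsetP => x; rewrite !inE => /and3P[xA xm xM].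
rewrite sAB //=; apply/andP; split.
- by apply: contra xm => /forall_inP h; apply/forall_inP => y /sAB /h.
- by apply: contra xM => /forall_inP h; apply/forall_inP => y /sAB /h.
Qed.

Definition order_complex A : {set {set T}} :=
  [set s : {set T} | (s \subset A) &&
                     [forall x in s, forall y in s, (x >=< y)%O]].

Definition is_chain A (m : nat) c : bool :=
  [forall s, (c s != 0) ==> ((s \in order_complex A) && (#|s| == m))].

(* On {x_0 < ... < x_k} this is the sum of (-1)^i times the face omitting x_i. *)
Definition boundary c : {ffun {set T} -> int} :=
  [ffun t : {set T} => \sum_(s : {set T}) \sum_(x in s | s :\ x == t)
              (-1) ^+ #|[set y in s | (y < x)%O]| * c s].

Lemma is_chain0 A m : is_chain A m 0.
Proof. by apply/forallP => s; rewrite ffunE eqxx. Qed.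

Lemma is_chainB A m c c' :
  is_chain A m c -> is_chain A m c' -> is_chain A m (c - c').
Proof.
move=> /forallP h /forallP h'; apply/forallP => s; apply/implyP.
rewrite !ffunE => nz; have [c0|cn] := eqVneq (c s) 0.
  apply: (implyP (h' s)); apply: contra nz => /eqP ->.
  by rewrite c0 subr0.
exact: (implyP (h s)).
Qed.

Lemma boundary0 : boundary 0 = 0.
Proof.
apply/ffunP => t; rewrite !ffunE big1 // => s _; rewrite big1 // => x _.
by rewrite ffunE mulr0.
Qed.

Lemma boundaryB c c' : boundary (c - c') = boundary c - boundary c'.
Proof.
apply/ffunP => t; rewrite !ffunE -sumrB; apply: eq_bigr => s _.
by rewrite -sumrB; apply: eq_bigr => x _; rewrite !ffunE mulrBr.
Qed.

Section Homology.
Variables (A : {set T}) (k : nat).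

Definition is_cycle : {pred {ffun {set T} -> int}} :=
  [pred c | is_chain A k.+1 c && (boundary c == 0)].

Fact is_cycle_zmod_closed : zmod_closed is_cycle.
Proof.
split=> [|c c']; rewrite !inE; first by rewrite is_chain0 boundary0 eqxx.
move=> /andP[h /eqP b] /andP[h' /eqP b'].
by rewrite is_chainB // boundaryB b b' subrr eqxx.
Qed.

HB.instance Definition _ :=
  GRing.isZmodClosed.Build {ffun {set T} -> int} is_cycle is_cycle_zmod_closed.

Record cycles : predArgType :=
  Cycle { cycle_chain :> {ffun {set T} -> int}; _ : cycle_chain \in is_cycle }.

HB.instance Definition _ := [isSub for cycle_chain].
HB.instance Definition _ := [Choice of cycles by <:].
HB.instance Definition _ := [SubChoice_isSubZmodule of cycles by <:].

(* Boundaries are cycles, so nothing is lost by taking this as a predicate on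
   cycles. *)
Definition is_boundary : {pred cycles} :=
  fun z => `[< exists2 c, is_chain A k.+2 c & boundary c = z :> {ffun _} >].

Fact is_boundary_zmod_closed : zmod_closed is_boundary.
Proof.
split=> [|z z' /asboolP[c hc ez] /asboolP[c' hc' ez']]; apply/asboolP.
  by exists 0; rewrite ?is_chain0 ?boundary0.
by exists (c - c'); rewrite ?is_chainB // boundaryB ez ez'.
Qed.

HB.instance Definition _ :=
  GRing.isZmodClosed.Build cycles is_boundary is_boundary_zmod_closed.

Definition homology : zmodType := Quotient.quot is_boundary.

Definition homology_class (z : cycles) : homology :=
  (\pi_(Quotient.quot is_boundary) z)%qT.

End Homology.

Lemma is_cycleS A B k c : A \subset B -> c \in is_cycle A k -> c \in is_cycle B k.
Proof.
rewrite !inE => sAB /andP[/forallP h ->]; rewrite andbT.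
apply/forallP => s; apply/implyP => /(implyP (h s)); rewrite !inE.
by move=> /andP[/andP[/subset_trans -> //]] -> ->.
Qed.

Definition cycle_incl A B k (sAB : A \subset B) (z : cycles A k) : cycles B k :=
  Cycle (is_cycleS sAB (valP z)).

End OrderComplex.

Definition Zbasis (V : zmodType) (I : finType) (e : I -> V) : Prop :=
  forall v : V, exists! a : {ffun I -> int}, v = \sum_i e i *~ a i.

(* For an order complex that is a k-sphere: a generator of its k-th reduced
   homology group, which is infinite cyclic.  As there is no face of dimension
   k+1, this determines the cycle z itself up to sign. *)
Definition fundamental_cycle d (T : finPOrderType d) (A : {set T}) (k : nat)
    (z : cycles A k) : Prop :=
  Zbasis (fun _ : unit => homology_class z).

Section SignedPartitions.
Variable n : nat.

(* The pair (a, true) is the barred letter, (a, false) the unbarred one. *)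
Definition letter : finType := ('I_n.+1 * bool)%type.
Implicit Types (b c : {set letter}) (x y : letter) (P : {set {set letter}}).

Definition zero_letter : letter := (ord0, false).

Definition bar b : {set letter} := [set (x.1, ~~ x.2) | x : letter in b].
Definition unbar b : {set letter} := [set (x.1, false) | x : letter in b].

Definition is_signed_partition P : bool :=
  [&& set0 \notin P, trivIset P,
      [forall i : 'I_n.+1,
         ((i, false) \in cover P) (+) ((i, true) \in cover P)]
    & [forall b in P, forall x in b, x.2 ==>
         ((zero_letter \notin b) && [exists y in b, (y.1 < x.1)%N])]].

Record signed_partition : predArgType :=
  SignedPartition { blocks :> {set {set letter}}; _ : is_signed_partition blocks }.

HB.instance Definition _ := [isSub for blocks].
HB.instance Definition _ := [Finite of signed_partition by <:].

Definition sp_le : rel signed_partition := fun p t =>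
  [forall b in blocks p, exists c in blocks t,
     if zero_letter \in c then unbar b \subset c
     else (b \subset c) || (bar b \subset c)].

Lemma in_bar b i s : ((i, s) \in bar b) = ((i, ~~ s) \in b).
Proof.
apply/imsetP/idP => [[[j r] jb [-> ->]]|ib]; first by rewrite negbK.
by exists (i, ~~ s); rewrite //= negbK.
Qed.

Lemma barK : involutive bar.
Proof. by move=> b; apply/setP => -[i s]; rewrite !in_bar negbK. Qed.

Lemma sp_uniq (p : signed_partition) b c i s s' :
  b \in blocks p -> c \in blocks p -> (i, s) \in b -> (i, s') \in c ->
  b = c /\ s = s'.
Proof.
case: p => P /= /and4P[_ /trivIsetP tP /forallP xP _] bP cP ib ic.
have ss : s = s'.
  have hs : (i, s) \in cover P by apply/bigcupP; exists b.
  have hs' : (i, s') \in cover P by apply/bigcupP; exists c.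
  by have := xP i; move: hs hs'; case: s s' {ib ic} => -[] // -> ->.
split=> //; apply/eqP/negPn/negP => /(tP _ _ bP cP) /disjoint_setI0 /setP/(_ (i, s)).
by rewrite !inE ib ss ic.
Qed.

Lemma sp_bars (p : signed_partition) b i :
  b \in blocks p -> (i, true) \in b ->
  zero_letter \notin b /\ exists2 y, y \in b & (y.1 < i)%N.
Proof.
case: p => P /= /and4P[_ _ _ /forall_inP h] /h /forall_inP {}h /h /=.
by case/andP => -> /exists_inP[y yb lt]; split=> //; exists y.
Qed.

Lemma sp_zero (p : signed_partition) b s :
  b \in blocks p -> (ord0, s) \in b -> zero_letter \in b.
Proof. by case: s => // bP /(sp_bars bP)[_ [y]]. Qed.

Lemma sp_min (p : signed_partition) b : b \in blocks p ->
  exists2 i, (i, false) \in b & forall y, y \in b -> (i <= y.1)%N.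
Proof.
move=> bP; have /set0Pn[x0 x0b] : b != set0.
  by apply: contraTneq bP => ->; case: p => P /= /and4P[].
case: (arg_minnP (fun x : letter => nat_of_ord x.1) x0b) => -[i s] ib mi.
exists i; last by move=> y /mi.
case: s ib mi => // /(sp_bars bP)[_ [y yb lt]] /(_ y yb) /=.
by rewrite leqNgt lt.
Qed.

Lemma sp_le_refl : reflexive sp_le.
Proof.
move=> p; apply/forall_inP => b bP; apply/exists_inP; exists b => //.
case: ifP => zb; last by rewrite subxx.
apply/subsetP => _ /imsetP[[i [] xb ->]] //=.
by have [] := sp_bars bP xb; rewrite zb.
Qed.

Lemma sp_leP p t : sp_le p t -> forall b, b \in blocks p ->
  exists2 c, c \in blocks t & [/\ forall i s, (i, s) \in b -> exists s', (i, s') \in c &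
    (if zero_letter \in c then unbar b \subset c
     else (b \subset c) || (bar b \subset c))].
Proof.
move=> /forall_inP h b /h /exists_inP[c cP hc]; exists c => //; split=> // i s ib.
move: hc; case: ifP => _.
  by move/subsetP=> hs; exists false; apply: hs; apply/imsetP; exists (i, s).
case/orP => /subsetP hs; first by exists s; apply: hs.
by exists (~~ s); apply: hs; rewrite in_bar negbK.
Qed.

Lemma sp_le_trans : transitive sp_le.
Proof.
move=> t p u /sp_leP h1 /sp_leP h2; apply/forall_inP => b /h1[c cP [bc hb]].
have [e eP [ce he]] := h2 c cP; apply/exists_inP; exists e => //.
move: he; case: ifP => ze he.
  apply/subsetP => _ /imsetP[[i s] /bc[s' ic] ->].
  by apply: (subsetP he); apply/imsetP; exists (i, s').
move: hb; case: ifP => zc hb.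
  by have [s /(sp_zero eP)] := ce _ _ zc; rewrite ze.
have barS (f g : {set letter}) : f \subset g -> bar f \subset bar g.
  by move=> /subsetP s; apply/subsetP => -[i s']; rewrite !in_bar => /s.
case/orP: hb => hb; case/orP: he => he.
- by rewrite (subset_trans hb he).
- by rewrite (subset_trans (barS _ _ hb) he) orbT.
- by rewrite (subset_trans hb he) orbT.
- by rewrite -[b]barK (subset_trans (barS _ _ hb) he).
Qed.

Lemma sp_le_anti : antisymmetric sp_le.
Proof.
suff sub p t : sp_le p t -> sp_le t p -> blocks p \subset blocks t.
  move=> p t /andP[pt tp]; apply: val_inj; apply/eqP.
  by rewrite eqEsubset !sub.
move=> /sp_leP h1 /sp_leP h2; apply/subsetP => b bP.
have [c cP [bc hb]] := h1 b bP; have [b' bP' [cb hc]] := h2 c cP.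
have [i ib mi] := sp_min bP.
have [s' ic] := bc _ _ ib; have [s'' ib'] := cb _ _ ic.
have [ebb _] := sp_uniq bP bP' ib ib'; subst b'.
suff -> : b = c by [].
suff sbc : b \subset c.
  apply/eqP; rewrite eqEsubset sbc; apply/subsetP => -[j s] jc.
  have [r jb] := cb _ _ jc.
  by have [_ ->] := sp_uniq cP cP jc (subsetP sbc _ jb).
move: hb; case: ifP => zc.
  have [s0 /(sp_zero bP) zb] := cb _ _ zc.
  move=> /subsetP h; apply/subsetP => -[j [] jb].
    by have [] := sp_bars bP jb; rewrite zb.
  by apply: h; apply/imsetP; exists (j, false).
case/orP => // /subsetP h.
have /(sp_bars cP)[_ [[j s] jc lt]] : (i, true) \in c by apply: h; rewrite in_bar.
by have [r /mi] := cb _ _ jc; rewrite leqNgt lt.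
Qed.

Fact signed_partition_display : Order.disp_t.
Proof. exact: (Order.Disp tt tt). Qed.

HB.instance Definition _ :=
  Order.Le_isPOrder.Build signed_partition_display signed_partition
    sp_le_refl sp_le_anti sp_le_trans.

Definition PiD : {set signed_partition} :=
  [set p : signed_partition | [forall b in blocks p, (zero_letter \in b) ==> (#|b| != 2%N)]].

(* Below, 'I_n encodes {1, ..., n} with a shift by one, both for the
   positions and for the values of a permutation; e i = true iff the letter at
   position i is barred. *)
Implicit Types (w : 'S_n) (e : {ffun 'I_n -> bool}) (S : {set 'I_n}).

Definition sgn_letter w e (q : 'I_n) : letter := (lift ord0 (w q), e q).

(* The splitting positions i_1 < ... < i_k are the elements of S, unshifted.
   With a position p encoded as q = p - 1, the range p <= i_1 reads q < i_1 and
   the range i_j + 1 <= p <= i_(j+1) reads i_j <= q < i_(j+1). *)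
Definition split_zero_block w S : {set letter} :=
  zero_letter |: [set (lift ord0 (w q), false) | q : 'I_n & [forall i in S, (q < i)%N]].

Definition split_block w e S (i : 'I_n) : {set letter} :=
  [set sgn_letter w e q | q : 'I_n &
     (i <= q)%N && [forall j in S, (i < j)%N ==> (q < j)%N]].

Definition min_unbarred b : bool :=
  [exists x in b, ~~ x.2 && [forall y in b, (x.1 <= y.1)%N]].

Definition normalize b : {set letter} := if min_unbarred b then b else bar b.

Definition split_blocks w e S : {set {set letter}} :=
  split_zero_block w S |: [set normalize (split_block w e S i) | i in S].

Lemma sgn_letter_pos w e e' q q' :
  (sgn_letter w e q).1 = (sgn_letter w e' q').1 -> q = q'.
Proof. by move=> /lift_inj /perm_inj. Qed.

Lemma in_normalize w e S i x : x \in normalize (split_block w e S i) ->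
  exists q : 'I_n, [/\ (i <= q)%N, forall j, j \in S -> (i < j)%N -> (q < j)%N &
    x.1 = lift ord0 (w q)].
Proof.
have aux r : (x.1, r) \in split_block w e S i -> exists q : 'I_n,
    [/\ (i <= q)%N, forall j, j \in S -> (i < j)%N -> (q < j)%N & x.1 = lift ord0 (w q)].
  case/imsetP=> q; rewrite !inE => /andP[iq /forall_inP h] [-> _].
  by exists q; split=> // j /h /implyP.
rewrite /normalize; case: ifP => _; case: x aux => j s aux; first exact: aux.
by rewrite in_bar; apply: aux.
Qed.

Lemma in_zero_block w S x : x \in split_zero_block w S ->
  x = zero_letter \/
  exists2 q : 'I_n, (forall i, i \in S -> (q < i)%N) & x = (lift ord0 (w q), false).
Proof.
rewrite !inE => /orP[/eqP|/imsetP[q]]; first by left.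
by rewrite !inE => /forall_inP h ->; right; exists q.
Qed.

Lemma split_block_sgn w e S i a r s :
  (a, r) \in split_block w e S i -> (a, s) \in split_block w e S i -> r = s.
Proof.
case/imsetP=> q _ E /imsetP[q' _ E'].
have qq : q = q'.
  by apply: (@sgn_letter_pos w e e); rewrite -(congr1 fst E) -(congr1 fst E').
by rewrite (congr1 snd E : r = e q) (congr1 snd E' : s = e q') qq.
Qed.

Lemma normalize_sgn w e S i a r s : (a, r) \in normalize (split_block w e S i) ->
  (a, s) \in normalize (split_block w e S i) -> r = s.
Proof.
rewrite /normalize; case: ifP => _; first exact: split_block_sgn.
by rewrite !in_bar => h h'; apply: negb_inj; apply: split_block_sgn h h'.
Qed.

Lemma split_blocks_uniq w e S b c a r s :
  b \in split_blocks w e S -> c \in split_blocks w e S ->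
  (a, r) \in b -> (a, s) \in c -> b = c /\ r = s.
Proof.
have lift0 (v : 'I_n) : lift ord0 v <> ord0 by [].
have zn i a' r' s' : i \in S -> (a', r') \in split_zero_block w S ->
    (a', s') \in normalize (split_block w e S i) -> False.
  move=> iS /in_zero_block[[-> _]|[q qS [-> _]]] /in_normalize[q' [iq' _ /= E]].
    by have := lift0 (w q'); rewrite -E.
  have /perm_inj eqq := lift_inj E; have := qS _ iS.
  by rewrite eqq ltnNge iq'.
rewrite !inE => /orP[/eqP->|/imsetP[i iS ->]] /orP[/eqP->|/imsetP[j jS ->]] h h'.
- split=> //.
  have f x : x \in split_zero_block w S -> x.2 = false.
    by move=> /in_zero_block[->|[q _ ->]].
  by rewrite (f _ h : r = _) (f _ h' : s = _).
- by have := zn _ _ _ _ jS h h'.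
- by have := zn _ _ _ _ iS h' h.
suff eij : i = j by subst j; split=> //; apply: normalize_sgn h h'.
have [q [iq qS E]] := in_normalize h; have [q' [jq' qS' E']] := in_normalize h'.
have /perm_inj eqq := lift_inj (etrans (esym E) E'); subst q'.
apply/val_inj/eqP; rewrite eqn_leq.
rewrite leqNgt; apply/andP; split.
  by apply/negP => /(qS' _ iS); rewrite ltnNge iq.
by rewrite leqNgt; apply/negP => /(qS _ jS); rewrite ltnNge jq'.
Qed.

Lemma split_blocks_cover w e S a :
  exists2 b, b \in split_blocks w e S & exists s, (a, s) \in b.
Proof.
case: (unliftP ord0 a) => [v ->|->]; last first.
  by exists (split_zero_block w S); [rewrite setU11|exists false; rewrite setU11].
set q := (w^-1)%g v; have -> : v = w q by rewrite permKV.
have [/existsP[i0 /andP[i0S i0q]]|/existsPn none] := boolP [exists i, (i \in S) && (i <= q)%N].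
  have P0 : [pred i : 'I_n | (i \in S) && (i <= q)%N] i0 by rewrite /= i0S.
  case: (arg_maxnP (fun i : 'I_n => nat_of_ord i) P0) => /= i /andP[iS iq] mi.
  exists (normalize (split_block w e S i)).
    by rewrite inE; apply/orP; right; apply: imset_f.
  have qb : sgn_letter w e q \in split_block w e S i.
    apply: imset_f; rewrite !inE iq; apply/forall_inP => j jS; apply/implyP.
    apply: contraTltn => jq; rewrite -leqNgt; apply: mi.
    by rewrite jS.
  rewrite /normalize; case: ifP => _; first by exists (e q).
  by exists (~~ e q); rewrite in_bar negbK.
exists (split_zero_block w S); first by rewrite setU11.
exists false; rewrite inE; apply/orP; right; apply/imsetP; exists q => //.
rewrite !inE; apply/forall_inP => i iS; have := none i.
by rewrite iS /= -ltnNge.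
Qed.

Lemma split_blocksP w e S : is_signed_partition (split_blocks w e S).
Proof.
apply/and4P; split.
- rewrite !inE; apply/norP; split.
    by apply/eqP => /setP/(_ zero_letter); rewrite !inE eqxx.
  apply/imsetP => -[i iS /esym E]; have : sgn_letter w e i \in split_block w e S i.
    by apply: imset_f; rewrite !inE leqnn; apply/forall_inP => j _; apply/implyP.
  move: E; rewrite /normalize; case: ifP => _ /setP E; first by rewrite E inE.
  by have := E ((sgn_letter w e i).1, ~~ e i); rewrite in_bar negbK inE => ->.
- apply/trivIsetP => b c bP cP; apply: contraNT => /pred0Pn[[a s] /andP[/= ab ac]].
  by have [->] := split_blocks_uniq bP cP ab ac.
- apply/forallP => a; have [b bP [s ab]] := split_blocks_cover w e S a.
  have h1 : (a, s) \in cover (split_blocks w e S) by apply/bigcupP; exists b.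
  have h2 : (a, ~~ s) \notin cover (split_blocks w e S).
    apply/bigcupP => -[c cP ac]; have [_] := split_blocks_uniq bP cP ab ac.
    by case: (s).
  by case: s {ab} h1 h2 => /= -> /negbTE ->.
apply/forall_inP => b bP; apply/forall_inP => -[a []] //= ab.
move: bP; rewrite !inE => /orP[/eqP E|/imsetP[i iS E]].
  by subst b; case/in_zero_block: ab => [//|[q _ //]].
subst b; apply/andP; split.
  by apply/negP => /in_normalize[q [_ _ /= E]]; have := neq_lift ord0 (w q); rewrite -E eqxx.
move: ab; rewrite /normalize; case: ifP => mb ab.
  case/exists_inP: mb => -[m s] mb /andP[/= /negbTE sF /forall_inP mm]; subst s.
  apply/exists_inP; exists (m, false) => //=.
  rewrite ltn_neqAle (mm _ ab) andbT; apply/eqP => /val_inj E; subst m.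
  by have := split_block_sgn ab mb.
rewrite in_bar /= in ab.
case: (arg_minnP (fun x : letter => nat_of_ord x.1) ab) => -[m s] mB mm.
case: s mB mm => mB mm.
  apply/exists_inP; exists (m, false); first by rewrite in_bar.
  rewrite ltn_neqAle (mm _ ab) andbT; apply/eqP => /val_inj E; rewrite /= in E; subst m.
  by have := split_block_sgn ab mB.
suff: min_unbarred (split_block w e S i) by rewrite mb.
apply/exists_inP; exists (m, false) => //=.
by apply/forall_inP => y yB; apply: (mm y).
Qed.

Definition splitting w e S : signed_partition := SignedPartition (split_blocksP w e S).

Definition negate_first e : {ffun 'I_n -> bool} :=
  [ffun i : 'I_n => (nat_of_ord i == 0%N) (+) e i].

(* The smallest element of S, if S is nonempty, is not 1. *)
Definition admissible S : bool :=
  [forall i in S, [forall j in S, (i <= j)%N] ==> (nat_of_ord i != 1%N)].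

Definition tPi w e : {set signed_partition} :=
  [set p in PiD | [exists S : {set 'I_n}, admissible S &&
                    ((p == splitting w e S) || (p == splitting w (negate_first e) S))]].

Lemma tPi_sub w e : tPi w e \subset PiD.
Proof. by apply/subsetP => p; rewrite inE => /andP[]. Qed.

Record Dn : predArgType :=
  DnElt { Dn_pair :> 'S_n * {ffun 'I_n -> bool};
          _ : ~~ odd #|[set i | Dn_pair.2 i]| }.

HB.instance Definition _ := [isSub for Dn_pair].
HB.instance Definition _ := [Finite of Dn by <:].

Definition rtl_max w (i : 'I_n) : bool :=
  [forall j : 'I_n, (i < j)%N ==> (w j < w i)%N].

(* With the shift by one, omega(1) <> n says that position 0 is not sent to n-1. *)
Definition basis_index (x : Dn) : bool :=
  [forall i : 'I_n, (nat_of_ord i == 0%N) ==> (nat_of_ord (x.1 i) != n.-1)] &&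
  [forall i : 'I_n, rtl_max x.1 i ==> ~~ x.2 i].

End SignedPartitions.

(* Main.v *)
Require Import Defs.
From mathcomp Require Import all_boot all_order all_fingroup all_algebra.
From mathcomp Require Import boolp zify.

(** The homology is top-dimensional, so it is the group of cycles, and a cycle
    is a function on maximal flags [F 0 < ... < F n] satisfying one linear
    relation for each flag with a step removed.

    Read flags from the bottom up and call a step good if the block of the
    largest letter [u] outside the zero block takes part in the merging.  In an
    interval of rank two at most one element leaves the block of [u] untouched,
    so the relations express the value of a cycle on any flag through its values
    on flags all of whose steps are good.  Such a flag is encoded by a signed
    permutation [(w, e)] whose right-to-left maxima are unbarred, with
    [w(1) <> n]: cut [w] after each right-to-left maximum and remove the cuts
    segment by segment, from right to left in each segment.  The relation at
    the step where [n] is about to enter the zero block pairs [e] with [e'] up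
    to flags where [n] enters earlier, so the flags [m_x] with [x] in [D_n]
    determine a cycle.

    Conversely the coefficient of [m_x] in [rho_x] is [1] or [-1], since any
    divisor of it divides all coefficients of [rho_x], by connectedness of the
    Boolean lattice.  If [m_y] lies in the support of [rho_x] then the sum over
    [i] of [max_(q >= i) w(q)] is at most as large for [x] as for [y], with
    equality only if [x = y]: the matrix of the [rho_x] on the [m_y] is
    unitriangular. *)

Set Implicit Arguments.
Unset Strict Implicit.
Unset Printing Implicit Defensive.

Import Order.TTheory GRing.Theory Num.Theory.

Local Open Scope nat_scope.

(** * Flags and top-dimensional cycles *)

Section Flags.
Local Open Scope ring_scope.
Context {d : Order.disp_t} {T : finPOrderType d}.
Variables (B : {set T}) (n : nat) (rk : T -> nat) (bot top : T).

(** Flags are functions on [nat], so that updates and shifted indices need no casts; values beyond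
    [n] are unconstrained. *)
Definition flag (F : nat -> T) : Prop :=
  [/\ forall k, (k <= n)%N -> F k \in B,
      forall k, (k < n)%N -> (F k < F k.+1)%O,
      F 0%N = bot & F n = top].

Definition facet (F : nat -> T) : {set T} := [set F k | k : 'I_n & (0 < k)%N].

Definition update (F : nat -> T) j q : nat -> T := fun k => if k == j then q else F k.

(** The common interface of [PiD] and of every [tPi]. The bounds are stated for all of [T] because
    both posets share the minimum and the maximum of the ambient order. *)
Record graded : Prop := Graded {
  graded_ge2 : (2 <= n)%N;
  graded_lt : forall p q, (p < q)%O -> (rk p < rk q)%N;
  graded_botB : bot \in B;
  graded_topB : top \in B;
  graded_bot_le : forall p, (bot <= p)%O;
  graded_le_top : forall p, (p <= top)%O;
  graded_bot : rk bot = 0%N;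
  graded_top : rk top = n }.

Hypothesis gr : graded.

Let n_ge2 := graded_ge2 gr.
Let rk_lt := graded_lt gr.
Let botB := graded_botB gr.
Let topB := graded_topB gr.
Let bot_le p (pB : p \in B) := graded_bot_le gr p.
Let le_top p (pB : p \in B) := graded_le_top gr p.
Let rk_bot := graded_bot gr.
Let rk_top := graded_top gr.

Lemma flag_lt F i j : flag F -> (i < j)%N -> (j <= n)%N -> (F i < F j)%O.
Proof.
case=> _ ltF _ _; elim: j => // j IH; rewrite ltnS leq_eqVlt => /predU1P[->|lij] ljn.
  exact: ltF.
by apply: lt_trans (ltF j ljn); apply: IH => //; apply: ltnW.
Qed.

Lemma flag_le F i j : flag F -> (i <= j)%N -> (j <= n)%N -> (F i <= F j)%O.
Proof.
move=> flF; rewrite leq_eqVlt => /predU1P[->|lij ljn]; first by rewrite lexx.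
exact/ltW/flag_lt.
Qed.

(** Counting up from the bottom gives [k <= rk (F k)]; counting down from the top, whose rank is
    [n], gives the reverse bound. *)
Lemma flag_rk F k : flag F -> (k <= n)%N -> rk (F k) = k.
Proof.
move=> flF; have [_ ltF F0 Fn] := flF.
have lo j : (j <= n)%N -> (j <= rk (F j))%N.
  elim: j => // j IH ljn; apply: leq_ltn_trans (IH (ltnW ljn)) _.
  exact/rk_lt/ltF.
have hi j : (j <= n)%N -> (rk (F (n - j)) + j <= n)%N.
  elim: j => [_|j IH ljn]; first by rewrite subn0 Fn rk_top addn0.
  apply: leq_trans (IH (ltnW ljn)); rewrite addnS -addSn leq_add2r.
  have -> : (n - j = (n - j.+1).+1)%N by lia.
  by apply/rk_lt/ltF; lia.
move=> lkn; have := lo k lkn; have := hi (n - k)%N (leq_subr _ _).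
by rewrite subKn //; lia.
Qed.

Lemma proper_partE p : (p \in proper_part B) = [&& p \in B, p != bot & p != top].
Proof.
rewrite inE; case pB: (p \in B) => //=; congr (~~ _ && ~~ _).
  apply/forall_inP/eqP => [le_p|-> q]; last exact: bot_le.
  by apply/le_anti; rewrite le_p // bot_le.
apply/forall_inP/eqP => [le_p|-> q]; last exact: le_top.
by apply/le_anti; rewrite le_p // le_top.
Qed.

Lemma proper_part_rk p : p \in proper_part B -> (0 < rk p < n)%N.
Proof.
rewrite proper_partE => /and3P[pB pb pt].
have /rk_lt : (bot < p)%O by rewrite lt_neqAle eq_sym pb bot_le.
have /rk_lt : (p < top)%O by rewrite lt_neqAle pt le_top.
by rewrite rk_bot rk_top => -> ->.
Qed.

Lemma facetP F x : reflect (exists2 k, (0 < k < n)%N & x = F k) (x \in facet F).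
Proof.
apply: (iffP imsetP) => [[k]|[k /andP[k0 kn] ->]].
  by rewrite inE => k0 ->; exists k; rewrite ?k0 /=.
by exists (Ordinal kn); rewrite ?inE.
Qed.

Lemma flag_inj F i j : flag F -> (i <= n)%N -> (j <= n)%N -> F i = F j -> i = j.
Proof. by move=> flF li lj /(congr1 rk); rewrite !flag_rk. Qed.

Lemma complex_rk_inj A x y : A \in order_complex (proper_part B) ->
  x \in A -> y \in A -> rk x = rk y -> x = y.
Proof.
rewrite inE => /andP[_ /forall_inP ch] /ch /forall_inP{}ch /ch.
case: (comparableP x y) => // /rk_lt lxy _ E; lia.
Qed.

(** The rank is injective on a chain and takes values strictly between 0 and [n]. *)
Lemma card_complex A : A \in order_complex (proper_part B) -> (#|A| <= n.-1)%N.
Proof.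
move=> Ac; have An : (n = n.-1.+1)%N by lia.
have sA x : x \in A -> (0 < rk x < n)%N.
  by move=> xA; apply: proper_part_rk; move: Ac; rewrite inE => /andP[/subsetP->].
pose h x : 'I_n.-1.+1 := inord (rk x).
have hE x : x \in A -> h x = rk x :> nat by move=> /sA ?; rewrite inordK //; lia.
have injh : {in A &, injective h}.
  by move=> x y xA yA /(congr1 val) /=; rewrite !hE //; apply: (complex_rk_inj Ac).
rewrite -(card_in_imset injh).
have c0 : #|[set~ (ord0 : 'I_n.-1.+1)]| = n.-1 by rewrite cardsC1 card_ord.
apply: leq_trans (eq_leq c0); apply/subset_leq_card/subsetP => _ /imsetP[x xA ->]; rewrite !inE.
by apply/eqP => /(congr1 val) /=; rewrite hE //; have := sA x xA; lia.
Qed.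

Lemma complex_flag A : A \in order_complex (proper_part B) -> #|A| = n.-1 ->
  exists2 F, flag F & A = facet F.
Proof.
move=> Ac cA; have An : (n = n.-1.+1)%N by lia.
have AP x : x \in A -> x \in proper_part B.
  by move: Ac; rewrite inE => /andP[/subsetP + _]; apply.
have sA x : x \in A -> (0 < rk x < n)%N by move/AP/proper_part_rk.
pose h x : 'I_n.-1.+1 := inord (rk x).
have hE x : x \in A -> h x = rk x :> nat by move=> /sA ?; rewrite inordK //; lia.
have hA : h @: A = [set~ ord0].
  apply/eqP; rewrite eqEcard; apply/andP; split; last first.
    have injh : {in A &, injective h}.
      by move=> x y xA yA /(congr1 val) /=; rewrite !hE //; apply: (complex_rk_inj Ac).
    by rewrite (card_in_imset injh) cardsC1 card_ord cA.
  apply/subsetP => _ /imsetP[x xA ->]; rewrite !inE.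
  by apply/eqP => /(congr1 val) /=; rewrite hE //; have := sA x xA; lia.
have ex k : (0 < k < n)%N -> exists2 x, x \in A & rk x = k.
  move=> kn; have : (inord k : 'I_n.-1.+1) \in h @: A.
    by rewrite hA !inE; apply/eqP => /(congr1 val); rewrite /= inordK; lia.
  case/imsetP => x xA /(congr1 val) /=; rewrite hE // inordK; last by lia.
  by exists x.
(* The ranks on [A] fill all of 1, ..., [n - 1], so the default [bot] of the choice is never
   reached. *)
pose F k := if k == 0%N then bot else if (n <= k)%N then top
            else odflt bot [pick x in A | rk x == k].
have FA k : (0 < k < n)%N -> F k \in A /\ rk (F k) = k.
  move=> kn; rewrite /F ifN; last by lia.
  rewrite ifN; last by lia.
  case: pickP => [x /andP[xA /eqP]//|none]; have [x xA rx] := ex k kn.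
  by have := none x; rewrite xA rx eqxx.
have F0 : F 0%N = bot by [].
have Fn : F n = top by rewrite /F leqnn ifN //; lia.
exists F; last first.
  apply/setP => x; apply/idP/facetP => [xA|[k /FA[FkA _] ->] //].
  have rx := sA x xA; exists (rk x) => //; have [FxA E] := FA _ rx.
  by apply: complex_rk_inj Ac xA FxA _.
split=> // k.
- move=> lkn; have [->|k0] := posnP k; first by rewrite F0.
  have [->|kn] := eqVneq k n; first by rewrite Fn.
  have /FA[/AP] : (0 < k < n)%N by lia.
  by rewrite proper_partE => /and3P[].
- move=> kn; have [k0|k0] := posnP k.
    subst k; rewrite F0; have [/AP + _] := FA 1%N ltac:(lia).
    by rewrite proper_partE lt_neqAle eq_sym => /and3P[/bot_le-> ->].
  have [kn1|kn1] := eqVneq k.+1 n.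
    rewrite kn1 Fn; have [/AP + _] := FA k ltac:(lia).
    by rewrite proper_partE lt_neqAle => /and3P[/le_top-> _ ->].
  have [FkA rk1] := FA k ltac:(lia); have [FkA' rk2] := FA k.+1 ltac:(lia).
  move: Ac; rewrite inE => /andP[_ /forall_inP/(_ _ FkA)/forall_inP/(_ _ FkA')].
  case: (comparableP (F k)) => //; last by move=> E; move: rk2; rewrite -E rk1; lia.
  by move=> /rk_lt; rewrite rk1 rk2; lia.
Qed.

Lemma flag_update F j q : flag F -> (0 < j < n)%N -> q \in B ->
  (F j.-1 < q < F j.+1)%O -> flag (update F j q).
Proof.
move=> [inB ltF F0 Fn] jn qB /andP[lq ql]; rewrite /update; split.
- by move=> k lkn; case: ifP => // _; apply: inB.
- move=> k lkn; case: eqP => [->|kj]; case: eqP => [E|k1j]; rewrite ?ltF //.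
  + lia.
  + by move: lq; rewrite -E.
- by rewrite ifN //; lia.
- by rewrite ifN //; lia.
Qed.

Lemma facet_update F j q : flag F -> (0 < j < n)%N ->
  facet (update F j q) = q |: (facet F :\ F j).
Proof.
move=> flF jn; apply/setP => x; rewrite !inE; apply/facetP/orP.
  case=> k kn ->; rewrite /update; have [_|kj] := eqVneq k j; first by left.
  right; apply/andP; split; last by apply/facetP; exists k.
  by apply/eqP => /(flag_inj flF); lia.
case=> [/eqP->|/andP[xj /facetP[k kn E]]].
  by exists j; rewrite /update ?eqxx.
exists k => //; rewrite /update ifN //; apply: contraNneq xj => <-.
by rewrite E.
Qed.

(** The pairs [(s, x)] with [s :\ x = t] are indexed by [x] alone: it must lie outside [t], and then
    [s] is [x |: t]. *)
Lemma boundary_ins (z : {ffun {set T} -> int}) (t : {set T}) :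
  boundary z t = \sum_(x | x \notin t)
     (-1) ^+ #|[set y in x |: t | (y < x)%O]| * z (x |: t).
Proof.
rewrite ffunE (exchange_big_dep predT) //=; rewrite [LHS](bigID [pred x | x \notin t]) /=.
rewrite [X in _ + X]big1 ?addr0; last first.
  move=> x /negPn xt; apply: big1 => s /andP[xs /eqP E].
  by move: xt; rewrite -E !inE eqxx.
apply: eq_bigr => x xt; rewrite (big_pred1 (x |: t)) // => s /=.
apply/andP/eqP => [[xs /eqP <-]|->]; first by rewrite setD1K.
by rewrite setU11 setU1K.
Qed.

Variable z : {ffun {set T} -> int}.
Hypothesis z_chain : is_chain (proper_part B) n.-1 z.
Hypothesis z_cycle : boundary z = 0.

Lemma chain_facet A : z A != 0 -> exists2 F, flag F & A = facet F.
Proof.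
move=> nz; have /andP[Ac /eqP cA] := implyP (forallP z_chain A) nz.
exact: complex_flag.
Qed.

(** This is the coefficient of the boundary at the facet with [F j] removed. All its terms carry the
    same sign, which can be cancelled. *)
Lemma flag_link F j : flag F -> (0 < j < n)%N ->
  \sum_(q in B | (F j.-1 < q < F j.+1)%O) z (facet (update F j q)) = 0.
Proof.
move=> flF jn; pose t := facet F :\ F j.
have Fjt : facet F = F j |: t.
  by rewrite setD1K //; apply/facetP; exists j.
have := congr1 (fun c : {ffun _ -> int} => c t) z_cycle.
rewrite boundary_ins ffunE => E.
suff : (-1) ^+ j.-1 * (\sum_(q in B | (F j.-1 < q < F j.+1)%O)
    z (facet (update F j q))) = 0 :> int.
  by move=> /eqP; rewrite mulf_eq0 signr_eq0 => /eqP.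
have tP k : (0 < k < n)%N -> k != j -> F k \in t.
  move=> kn kj; rewrite !inE; apply/andP; split; last by apply/facetP; exists k.
  by apply: contra kj => /eqP/(flag_inj flF) ->; lia.
rewrite -[RHS]E [RHS](bigID (fun q => (q \in B) && (F j.-1 < q < F j.+1)%O)) /=.
rewrite [X in _ + X]big1 ?addr0.
  rewrite mulr_sumr; apply: eq_big => [q|q /andP[qB lq]].
    case: (boolP ((q \in B) && (F j.-1 < q < F j.+1)%O)) => [|_]; last by rewrite andbF.
    move=> /andP[qB /andP[lq ql]]; rewrite andbT; symmetry; apply/setD1P => -[qj /facetP[k kn Ek]].
    have rj1 : rk (F j.-1) = j.-1 by rewrite flag_rk //; lia.
    have rj2 : rk (F j.+1) = j.+1 by rewrite flag_rk //; lia.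
    have rj3 : rk q = k by rewrite Ek flag_rk //; lia.
    have := rk_lt lq; have := rk_lt ql; rewrite rj1 rj2 rj3 => h1 h2.
    by move: qj; rewrite Ek (_ : k = j) ?eqxx //; lia.
  rewrite facet_update //; congr (_ ^+ _ * _).
  have flq := flag_update flF jn qB lq.
  (* The elements below [q] are [F 1], ..., [F j.-1], whatever [q] is, so the sign depends on [j]
     only. *)
  have -> : [set y in q |: t | (y < q)%O] = [set F k.+1 | k : 'I_j.-1].
    apply/setP => y; rewrite inE -facet_update //; apply/andP/imsetP.
      case=> /facetP[k kn ->] lt.
      have kj : (k < j)%N.
        rewrite ltnNge; apply/negP => jk.
        have : (update F j q j <= update F j q k)%O by apply: flag_le => //; lia.
        by rewrite {1}/update eqxx => le; have := lt_le_trans lt le; rewrite ltxx.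
      have kj1 : (k.-1 < j.-1)%N by lia.
      exists (Ordinal kj1) => //=; rewrite prednK; last by lia.
      by rewrite /update ifN //; lia.
    case=> k _ ->; have kj := ltn_ord k.
    have E1 : update F j q k.+1 = F k.+1 by rewrite /update ifN //; lia.
    split; first by apply/facetP; exists k.+1 => //; lia.
    have : (update F j q k.+1 < update F j q j)%O by apply: flag_lt => //; lia.
    by rewrite E1 {1}/update eqxx.
  rewrite card_imset ?card_ord // => k k' /(flag_inj flF) E1; apply: val_inj.
  have kj := ltn_ord k; have kj' := ltn_ord k'.
  by case: (E1 ltac:(lia) ltac:(lia)).
move=> x /andP[xt nx]; apply/eqP; rewrite mulf_eq0 signr_eq0 /=.
apply: contraR nx => nz; have /andP[Ac /eqP cA] := implyP (forallP z_chain _) nz.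
have xP : x \in proper_part B by move: Ac; rewrite inE => /andP[/subsetP-> //]; rewrite setU11.
have xB : x \in B by move: xP; rewrite proper_partE => /andP[].
have rx := proper_part_rk xP; rewrite xB /=.
(* Every other rank is already occupied in [t]. Having rank [j] and being comparable to its
   neighbours, [x] lies in the open interval. *)
have rxj : rk x = j.
  apply/eqP/negPn/negP => rxj; have Ft := tP _ rx rxj.
  have : x = F (rk x).
    apply: (complex_rk_inj Ac); first by rewrite setU11.
      by rewrite inE Ft orbT.
    by rewrite flag_rk //; lia.
  by move=> E1; move: xt; rewrite E1 Ft.
have cmp k : (k <= n)%N -> k != j -> (x >=< F k)%O.
  move=> kn kj; have [k0|k0] := posnP k.
    by case: flF => _ _ F0 _; rewrite k0 F0 /Order.comparable bot_le ?orbT.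
  have [kn1|kn1] := eqVneq k n.
    by case: flF => _ _ _ Fn; rewrite kn1 Fn /Order.comparable le_top.
  move: Ac; rewrite inE => /andP[_ /forall_inP/(_ x)].
  rewrite setU11 => /(_ isT) /forall_inP; apply; rewrite inE tP ?orbT //; lia.
have rk1 : rk (F j.-1) = j.-1 by rewrite flag_rk //; lia.
have rk2 : rk (F j.+1) = j.+1 by rewrite flag_rk //; lia.
apply/andP; split.
  have := cmp j.-1 ltac:(lia) ltac:(lia).
  case: (comparableP x) => // [/rk_lt|/(congr1 rk)]; rewrite rk1 rxj; lia.
have := cmp j.+1 ltac:(lia) ltac:(lia).
case: (comparableP x) => // [/rk_lt|/(congr1 rk)]; rewrite rk2 rxj; lia.
Qed.

(* The exchange argument: at its first bad step [k] a flag stays bad up to some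
   index [j]; by uniqueness every other flag through the same codimension one
   face is touched earlier, so induction on [j] moves the value of the cycle to
   flags with more leading good steps. *)
Lemma peel (D : int) (bad : nat -> T -> T -> bool) (P : (nat -> T) -> Prop) (i0 : nat) :
  (i0 <= n)%N ->
  (forall F k, flag F -> (k < n)%N -> ~~ bad k (F k) top) ->
  (forall F k j q, flag F -> flag (update F j q) -> (k < j < n)%N ->
     (forall i, (i < k)%N -> ~~ bad i (F i) (F i.+1)) ->
     bad k (F k) (F j) -> bad k (F k) q -> ~~ bad k (F k) (F j.+1) -> q = F j) ->
  (forall F j q, (i0 < j)%N -> P F -> P (update F j q)) ->
  (forall F, flag F -> P F ->
     (forall k, (k < n)%N -> ~~ bad k (F k) (F k.+1)) -> (D %| z (facet F))%Z) ->
  forall F, flag F -> P F ->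
     (forall k, (k < i0)%N -> ~~ bad k (F k) (F k.+1)) -> (D %| z (facet F))%Z.
Proof.
move=> li0 badtop badU PU Hgood.
(* Outer induction on [n - k], with [k] the number of leading steps known to be good; the inner one,
   in [Q], is on the index [j] where badness of step [k] has ended. Divisibility includes vanishing
   as the case [D = 0]. *)
suff main m : forall k, (n - k = m)%N -> (i0 <= k <= n)%N -> forall F, flag F -> P F ->
    (forall i, (i < k)%N -> ~~ bad i (F i) (F i.+1)) -> (D %| z (facet F))%Z.
  by move=> F flF PF gF; apply: (main (n - i0)%N i0) => //; lia.
elim: m => [|m IHm] k km kn F flF PF gF.
  by apply: Hgood => // i lin; apply: gF; lia.
suff Q j : (k <= j < n)%N -> forall F, flag F -> P F ->
    (forall i, (i < k)%N -> ~~ bad i (F i) (F i.+1)) ->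
    ~~ bad k (F k) (F j.+1) -> (D %| z (facet F))%Z.
  apply: (Q n.-1) => //; first by lia.
  rewrite prednK; last by lia.
  have [_ _ _ ->] := flF; apply: badtop => //; lia.
elim: j {F flF PF gF} => [|j IHj] jn F flF PF gF gj.
  apply: (IHm k.+1) => //; try lia.
  move=> i; rewrite ltnS leq_eqVlt => /predU1P[->|]; last exact: gF.
  by have E : k = 0%N by [lia]; move: gj; rewrite -E.
have [kj|kj] := eqVneq k j.+1.
  apply: (IHm k.+1) => //; try lia.
  move=> i; rewrite ltnS leq_eqVlt => /predU1P[->|]; last exact: gF.
  by move: gj; rewrite -kj.
have [bj|gj'] := boolP (bad k (F k) (F j.+1)); last by apply: IHj => //; lia.
have jn' : (0 < j.+1 < n)%N by lia.
have lkj : (k < j.+1)%N by lia.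
have jn1 : (k <= j < n)%N by lia.
have li0j : (i0 < j.+1)%N by lia.
have lkjn : (k < j.+1 < n)%N by lia.
(* The relation at index [j.+1] trades [F] for flags through some [q] other than [F j.+1]; by
   uniqueness such a [q] is no longer bad, so the induction on [j] applies. *)
have := flag_link flF jn'; have [inB _ _ _] := flF.
have Fj : (F j.+1 \in B) && (F j < F j.+1 < F j.+2)%O.
  by rewrite inB ?(flag_lt flF) //; lia.
rewrite (bigD1 (F j.+1)) //= => /eqP; rewrite addr_eq0 => /eqP.
have -> : facet (update F j.+1 (F j.+1)) = facet F.
  rewrite facet_update // setD1K //; apply/facetP; exists j.+1 => //; lia.
move=> ->; rewrite rpredN; apply: rpred_sum => q /andP[/andP[qB lq] qF].
have flq := flag_update flF jn' qB lq.
have Eu i : (i <= k)%N -> update F j.+1 q i = F i.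
  by move=> lik; rewrite /update ltn_eqF // (leq_ltn_trans lik).
apply: (IHj jn1) => //.
- exact: PU.
- by move=> i lik; rewrite !Eu //; [apply: gF|apply: ltnW].
rewrite Eu // /update eqxx; apply: contra qF => bq; apply/eqP.
exact: (badU F k j.+1 q).
Qed.

End Flags.

(** * Top homology as the group of cycles *)

Section TopHomology.
Local Open Scope ring_scope.
Context {d : Order.disp_t} {T : finPOrderType d}.
Variables (B : {set T}) (n : nat) (rk : T -> nat) (bot top : T).
Hypothesis gr : graded B n rk bot top.

Notation A := (proper_part B).
Notation H := (homology A (n - 2)).
Implicit Types z : cycles A (n - 2).

Lemma cycle_dim : (n - 2).+1 = n.-1.
Proof. by have := graded_ge2 gr; lia. Qed.

Lemma cycle_is_chain z : is_chain A n.-1 z.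
Proof. by rewrite -cycle_dim; case: z => c /= /andP[]. Qed.

Lemma cycle_boundary z : boundary z = 0.
Proof. by case: z => c /= /andP[_ /eqP]. Qed.

(** A bounding chain would live on faces with [n] elements, and chains of the proper part have at
    most [n - 1]. *)
Lemma homology_class_inj : injective (@homology_class _ _ A (n - 2)).
Proof.
move=> z z' /eqP; rewrite /homology_class -Quotient.idealrBE => /asboolP[c cc cb].
suff c0 : c = 0.
  apply/eqP; rewrite -subr_eq0; apply/eqP/val_inj/esym.
  by rewrite c0 boundary0 in cb; apply: cb.
apply/ffunP => s; rewrite ffunE; apply/eqP/negPn/negP => nz.
have /andP[sA /eqP cs] := implyP (forallP cc s) nz.
by have := card_complex gr sA; have := graded_ge2 gr; lia.
Qed.

Lemma homology_class_sum (I : finType) (z_ : I -> cycles A (n - 2)) (a : I -> int) :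
  \sum_i homology_class (z_ i) *~ a i = homology_class (\sum_i z_ i *~ a i).
Proof. by rewrite /homology_class raddf_sum; apply: eq_bigr => i _; rewrite raddfMz. Qed.

Lemma cycle_sumE (I : finType) (z_ : I -> cycles A (n - 2)) (a : I -> int) s :
  (\sum_i z_ i *~ a i : cycles A (n - 2)) s = \sum_i a i * z_ i s.
Proof.
have -> : cycle_chain (\sum_i z_ i *~ a i) = \sum_i cycle_chain (z_ i) *~ a i.
  rewrite -[LHS]/(\val _) raddf_sum; apply: eq_bigr => i _.
  by rewrite raddfMz.
rewrite sum_ffunE; apply: eq_bigr => i _.
by rewrite ffunMzE -mulrzr intz mulrC.
Qed.

Lemma boundary_scale (D : int) (c : {ffun {set T} -> int}) :
  boundary [ffun s => D * c s] = [ffun t => D * boundary c t].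
Proof.
apply/ffunP => t; rewrite !ffunE mulr_sumr; apply: eq_bigr => s _.
by rewrite mulr_sumr; apply: eq_bigr => x _; rewrite ffunE mulrCA.
Qed.

(* A common divisor of all coefficients can be divided out of a cycle, so it is
   a unit for a generator of the cycle group. *)
Lemma fundamental_unit (z : cycles A (n - 2)) (s0 : {set T}) :
  (forall D : int, (D %| z s0)%Z -> forall F, flag B n bot top F -> (D %| z (facet n F))%Z) ->
  fundamental_cycle z -> (`|z s0| = 1)%N.
Proof.
move=> dvd fund; set D := z s0.
have dvdD s : (D %| z s)%Z.
  have [->|nz] := eqVneq (z s) 0; first exact: dvdz0.
  have [F flF ->] := chain_facet gr (cycle_is_chain z) nz.
  exact: dvd.
pose c : {ffun {set T} -> int} := [ffun s => (z s %/ D)%Z].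
have zc : z = [ffun s => D * c s] :> {ffun _ -> _}.
  by apply/ffunP => s; rewrite !ffunE mulrC divzK.
(* If [D] were zero, so would be [z], and the coefficients 0 and 1 would both represent the zero
   class. *)
have D0 : D != 0.
  apply/eqP => D0; have z0 : z = 0.
    by apply: val_inj; rewrite /= zc; apply/ffunP => s; rewrite !ffunE D0 mul0r.
  have [a [_ uniq]] := fund 0.
  have E1 : a = [ffun=> 0] by apply: uniq; rewrite big1 // => i _; rewrite ffunE mulr0z.
  have E2 : a = [ffun=> 1].
    apply: uniq; rewrite homology_class_sum z0 big1 /homology_class ?raddf0 // => i _.
    by rewrite mul0rz.
  by have := congr1 (fun f : {ffun unit -> int} => f tt) (etrans (esym E1) E2); rewrite !ffunE.
have c_cycle : c \in is_cycle A (n - 2).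
  rewrite inE; apply/andP; split.
    apply/forallP => s; apply/implyP => nz; rewrite cycle_dim.
    apply: (implyP (forallP (cycle_is_chain z) s)); apply: contra nz => /eqP zs.
    by rewrite ffunE zs div0z.
  apply/eqP/ffunP => t; have := congr1 (fun f : {ffun _ -> int} => f t) (cycle_boundary z).
  rewrite zc boundary_scale [X in X = _]ffunE => E; apply/eqP.
  have /eqP : D * boundary c t = 0 by rewrite E; apply: ffunE.
  by rewrite mulf_eq0 (negbTE D0) => /eqP ->; rewrite ffunE.
(* The quotient [c] is an integer multiple of [z], and its value at [s0] is 1; so [D] divides 1. *)
have [a [Ea _]] := fund (homology_class (Cycle c_cycle)).
move: Ea; rewrite homology_class_sum => /homology_class_inj /(congr1 (fun y : cycles _ _ => y s0)).
rewrite cycle_sumE (big_pred1 tt) /=; last by case.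
rewrite ffunE divzz D0 => /esym /(congr1 absz).
by rewrite abszM => /eqP; rewrite muln_eq1 => /andP[_ /eqP].
Qed.

End TopHomology.

(** * Unitriangular integer matrices *)

Section Unitriangular.
Local Open Scope ring_scope.
Variables (X : finType) (M : X -> X -> int) (Phi : X -> nat).
Hypothesis M_unit : forall x, (`|M x x| = 1)%N.
Hypothesis M_tri : forall x y, M x y != 0 -> x != y -> (Phi x < Phi y)%N.

Let M_sq x : M x x * M x x = 1.
Proof. by have := M_unit x; nia. Qed.

(** Induction on [Phi]: in the equation for [x], all other nonzero entries belong to rows of smaller
    [Phi], whose coefficients already vanish. *)
Lemma triangular_inj (a : X -> int) :
  (forall y, \sum_x a x * M x y = 0) -> forall x, a x = 0.
Proof.
move=> a0 x; have [m] := ubnP (Phi x); elim: m x => // m IH x; rewrite ltnS => xm.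
have := a0 x; rewrite (bigD1 x) //= big1 ?addr0; last first.
  move=> y yx; have [->|nz] := eqVneq (M y x) 0; first by rewrite mulr0.
  by rewrite IH ?mul0r //; apply: leq_trans xm; apply: M_tri.
by move=> /(congr1 ( *%R^~ (M x x))); rewrite -mulrA M_sq mulr1 mul0r.
Qed.

(** The equations are solved level by level in [Phi]; a correction on level [m] changes no equation
    below and, on level [m], only its own. *)
Lemma triangular_surj (b : X -> int) :
  exists a : {ffun X -> int}, forall y, \sum_x a x * M x y = b y.
Proof.
suff H m : exists a : {ffun X -> int},
    forall y, (Phi y < m)%N -> \sum_x a x * M x y = b y.
  have [a aP] := H (\max_x Phi x).+1; exists a => y; apply: aP.
  by rewrite ltnS; apply: leq_bigmax.
elim: m => [|m [a aP]]; first by exists [ffun=> 0].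
pose r y := b y - \sum_x a x * M x y.
(* The diagonal entry is 1 or -1, hence its own inverse, and multiplying the residue by it solves
   the equation. *)
exists [ffun x => a x + (if Phi x == m then r x * M x x else 0)] => y.
have -> : \sum_x [ffun x => a x + (if Phi x == m then r x * M x x else 0)] x * M x y =
    \sum_x a x * M x y + \sum_x (if Phi x == m then r x * M x x else 0) * M x y.
  by rewrite -big_split; apply: eq_bigr => x _; rewrite ffunE mulrDl.
rewrite ltnS leq_eqVlt => /predU1P[ym|ym].
  rewrite [X in _ + X](bigD1 y) //= ym eqxx [X in _ + (_ + X)]big1 ?addr0.
    by rewrite -mulrA M_sq mulr1 addrC /r subrK.
  move=> x xy; case: eqP => [xm|_]; last by rewrite mul0r.
  have [->|nz] := eqVneq (M x y) 0; first by rewrite mulr0.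
  by have := M_tri nz xy; rewrite xm ym ltnn.
rewrite aP // [X in _ + X]big1 ?addr0 // => x _.
case: eqP => [xm|_]; last by rewrite mul0r.
have [->|nz] := eqVneq (M x y) 0; first by rewrite mulr0.
have [E|xy] := eqVneq x y; first by move: ym; rewrite -E xm ltnn.
by have := M_tri nz xy; rewrite xm ltnNge ltnW.
Qed.

End Unitriangular.

(** * Signed partitions as signed equivalence relations *)

Section SignedPartitionTheory.
Variable n : nat.
Implicit Types (p q : signed_partition n) (i j k : 'I_n.+1).

Definition same p i j : bool :=
  [exists b in blocks p, [exists s, (i, s) \in b] && [exists s, (j, s) \in b]].

Definition sg p i : bool := (i, true) \in cover (blocks p).

Lemma sg_block p (b : {set letter n}) i s : b \in blocks p -> (i, s) \in b -> s = sg p i.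
Proof.
move=> bp ib; rewrite /sg; case: s ib => ib; symmetry.
  by apply/bigcupP; exists b.
by apply/bigcupP => -[c cp ic]; have [] := sp_uniq bp cp ib ic.
Qed.

Lemma block_of p i : exists2 b, b \in blocks p & (i, sg p i) \in b.
Proof.
have : ((i, false) \in cover (blocks p)) (+) ((i, true) \in cover (blocks p)).
  by case: p => P /= /and4P[_ _ /forallP].
rewrite -/(sg p i); case E: (sg p i); last by rewrite addbF => /bigcupP[b]; exists b.
by move: E => /bigcupP[b]; exists b.
Qed.

Lemma sameP p i j : reflect
  (exists2 b, b \in blocks p & (i, sg p i) \in b /\ (j, sg p j) \in b) (same p i j).
Proof.
apply: (iffP exists_inP) => -[b bp].
  case/andP=> /existsP[s ib] /existsP[t jb]; exists b => //.
  by rewrite -(sg_block bp ib) -(sg_block bp jb).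
by case=> ib jb; exists b => //; apply/andP; split; apply/existsP; eexists; eassumption.
Qed.

Lemma same_refl p i : same p i i.
Proof. by apply/sameP; have [b bp ib] := block_of p i; exists b. Qed.

Lemma same_sym p i j : same p i j = same p j i.
Proof. by apply/sameP/sameP => -[b bp [ib jb]]; exists b. Qed.

Lemma same_trans p j i k : same p i j -> same p j k -> same p i k.
Proof.
move=> /sameP[b bp [ib jb]] /sameP[c cp [jc kc]]; apply/sameP.
by have [E _] := sp_uniq bp cp jb jc; subst c; exists b.
Qed.

Lemma same_congr p i j k : same p i j -> same p i k = same p j k.
Proof.
move=> ij; apply/idP/idP; apply: same_trans => //.
by rewrite same_sym.
Qed.

Lemma same_congr_r p i j k : same p i j -> same p k i = same p k j.
Proof. by rewrite !(same_sym p k); apply: same_congr. Qed.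

Lemma sg0 p : sg p ord0 = false.
Proof.
have [b bp] := block_of p ord0; case: (sg _ _) => //.
by case/(sp_bars bp) => _ [y].
Qed.

Lemma sg_zero p i : same p ord0 i -> sg p i = false.
Proof.
move=> /sameP[b bp]; rewrite sg0 => -[zb]; case: (sg p i) => //.
by case/(sp_bars bp); rewrite zb.
Qed.

(** A block may enter another one after being barred as a whole, so only relative signs inside a
    block count, and none once it is absorbed by the zero block. *)
Lemma sp_le_same p q : reflect
  (forall i j, same p i j -> same q i j /\
     (~~ same q ord0 i -> sg p i (+) sg p j = sg q i (+) sg q j))
  (p <= q)%O.
Proof.
apply: (iffP idP) => [le_pq i j /sameP[b bp [ib jb]]|le_pq].
  have [c cq [_]] := sp_leP le_pq bp; case: ifP => zc.
    move=> /subsetP sub.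
    have ic : (i, false) \in c by apply: sub; apply/imsetP; exists (i, sg p i).
    have jc : (j, false) \in c by apply: sub; apply/imsetP; exists (j, sg p j).
    have zi k : (k, false) \in c -> same q ord0 k.
      move=> kc; apply/sameP; exists c => //.
      by rewrite -(sg_block cq zc) -(sg_block cq kc).
    by split; [rewrite -(same_congr _ (zi i ic)) zi|rewrite zi].
  case/orP => /subsetP sub.
    have ic := sub _ ib; have jc := sub _ jb.
    have Ei := sg_block cq ic; have Ej := sg_block cq jc.
    by split=> [|_]; [apply/sameP; exists c; rewrite -?Ei -?Ej|rewrite -Ei -Ej].
  have ic : (i, ~~ sg p i) \in c by apply: sub; rewrite in_bar negbK.
  have jc : (j, ~~ sg p j) \in c by apply: sub; rewrite in_bar negbK.
  have Ei := sg_block cq ic; have Ej := sg_block cq jc.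
  split=> [|_]; first by apply/sameP; exists c; rewrite -?Ei -?Ej.
  by rewrite -Ei -Ej addbN addNb negbK.
apply/forall_inP => b bp; have [i ib _] := sp_min bp.
have sgi := sg_block bp ib; have [c cq ic] := block_of q i.
have bc j s : (j, s) \in b -> [/\ s = sg p j, (j, sg q j) \in c, same q i j &
    ~~ same q ord0 i -> sg p i (+) sg p j = sg q i (+) sg q j].
  move=> jb; have sgj := sg_block bp jb.
  have [] : same q i j /\
     (~~ same q ord0 i -> sg p i (+) sg p j = sg q i (+) sg q j).
    by apply: le_pq; apply/sameP; exists b; rewrite -?sgi -?sgj.
  move=> ij E; split=> //; have /sameP[c' c'q [ic' jc']] := ij.
  by have [-> _] := sp_uniq cq c'q ic ic'.
apply/exists_inP; exists c => //; case: ifP => zc.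
  apply/subsetP => _ /imsetP[[j s] /bc[_ jc ij _] ->] /=.
  have zi : same q ord0 i by apply/sameP; exists c; rewrite // -(sg_block cq zc).
  by have <- : sg q j = false by apply: sg_zero; apply: same_trans ij.
have nz : ~~ same q ord0 i.
  apply/negP => /sameP[c' c'q [zc' ic']]; have [E _] := sp_uniq cq c'q ic ic'.
  by move: zc' zc; rewrite -E sg0 => ->.
(* The sign at one letter decides whether [b] itself or [bar b] lies in [c]. *)
have [E|NE] := eqVneq (sg p i) (sg q i); apply/orP; [left|right].
  apply/subsetP => -[j s] /bc[-> jc _ /(_ nz)]; rewrite E.
  by move/addbI => ->.
apply/subsetP => -[j s]; rewrite in_bar => /bc[sE jc _ /(_ nz)].
by move: NE; rewrite -sgi -sE; case: (sg q i) => // _ /= /negb_inj ->.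
Qed.

Lemma sp_le_sub p q i j : (p <= q)%O -> same p i j -> same q i j.
Proof. by move=> /sp_le_same h /h[]. Qed.

Lemma sp_le_sg p q i j : (p <= q)%O -> same p i j -> ~~ same q ord0 i ->
  sg p i (+) sg p j = sg q i (+) sg q j.
Proof. by move=> /sp_le_same h /h[]. Qed.

Lemma sp_ext p q : (forall i j, same p i j = same q i j) ->
  (forall i j, same p i j -> ~~ same p ord0 i ->
     sg p i (+) sg p j = sg q i (+) sg q j) -> p = q.
Proof.
move=> E1 E2; apply/le_anti/andP; split; apply/sp_le_same => i j.
  by move=> ij; rewrite -!E1; split=> // nz; apply: E2.
by rewrite -!E1 => ij; split=> // nz; rewrite E2.
Qed.

(** A canonical representative for each block. The largest letter is chosen because a letter that is
    largest in its block stays so in any smaller block: going up in the order, roots can only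
    disappear. *)
Definition root p i : 'I_n.+1 :=
  if same p ord0 i then ord0 else [arg max_(j > i | same p i j) (j : nat)].

Definition roots p : {set 'I_n.+1} := [set i | root p i == i].

Lemma same_root p i : same p i (root p i).
Proof.
rewrite /root; case: ifP => [|_]; first by rewrite same_sym.
by case: arg_maxnP => //; apply: same_refl.
Qed.

Lemma root_max p i j : ~~ same p ord0 i -> same p i j -> j <= root p i.
Proof.
move=> nz ij; rewrite /root (negbTE nz).
by case: arg_maxnP => [|k _]; [apply: same_refl|apply].
Qed.

Lemma root_eq p i j : (root p i == root p j) = same p i j.
Proof.
apply/eqP/idP => [E|ij].
  by apply: same_trans (same_root p i) _; rewrite E same_sym same_root.
rewrite /root (same_congr_r _ ij); case: ifP => // zj.
have zi : ~~ same p ord0 i by rewrite (same_congr_r _ ij) zj.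
case: arg_maxnP => [|k ik maxk]; first exact: same_refl.
case: arg_maxnP => [|l jl maxl]; first exact: same_refl.
apply/val_inj/eqP; rewrite eqn_leq; apply/andP; split.
  by apply: maxl; rewrite -(same_congr _ ij).
by apply: maxk; apply: same_trans jl.
Qed.

Lemma rootK p i : root p (root p i) = root p i.
Proof. by apply/eqP; rewrite root_eq same_sym same_root. Qed.

Lemma root_in p i : root p i \in roots p.
Proof. by rewrite inE rootK. Qed.

Lemma root_id p i : i \in roots p -> root p i = i.
Proof. by rewrite inE => /eqP. Qed.

Lemma roots_uniq p i j : i \in roots p -> j \in roots p -> same p i j -> i = j.
Proof. by rewrite -root_eq => /root_id -> /root_id -> /eqP. Qed.

Lemma root0 p : root p ord0 = ord0.
Proof. by rewrite /root same_refl. Qed.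

Lemma ord0_roots p : ord0 \in roots p.
Proof. by rewrite inE root0. Qed.

Lemma roots_zero p i : i \in roots p -> same p ord0 i = (i == ord0).
Proof.
move=> ir; apply/idP/eqP => [|->]; last exact: same_refl.
by move/(roots_uniq (ord0_roots p) ir).
Qed.

Lemma rootsP p i : ~~ same p ord0 i ->
  reflect (forall j, same p i j -> j <= i) (i \in roots p).
Proof.
move=> nz; apply: (iffP idP) => [/root_id E j ij|mi].
  by rewrite -E root_max.
rewrite inE; apply/eqP/val_inj/eqP; rewrite eqn_leq mi ?same_root //=.
by rewrite root_max ?same_refl.
Qed.

Lemma roots_sub p q : (p <= q)%O -> roots q \subset roots p.
Proof.
move=> le_pq; apply/subsetP => i iq; have [->|i0] := eqVneq i ord0.
  exact: ord0_roots.
have nzq : ~~ same q ord0 i by rewrite roots_zero.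
have nzp : ~~ same p ord0 i by apply: contra nzq; apply: sp_le_sub.
apply/(rootsP nzp) => j /(sp_le_sub le_pq); exact: (rootsP nzq iq).
Qed.

(** If no root is lost, the [p]-roots of two letters in one block of [q] are [q]-roots of that
    block, hence equal; so nothing was merged. *)
Lemma roots_eq p q : (p <= q)%O -> roots p = roots q -> p = q.
Proof.
move=> le_pq E; have S i j : same p i j = same q i j.
  apply/idP/idP => [|ij]; first exact: sp_le_sub.
  rewrite -root_eq; apply/eqP; apply: (@roots_uniq q); rewrite -?E ?root_in //.
  rewrite -(same_congr _ (sp_le_sub le_pq (same_root p i))).
  by rewrite -(same_congr_r _ (sp_le_sub le_pq (same_root p j))).
apply: sp_ext => // i j ij; rewrite S; exact: sp_le_sg.
Qed.

(** There is one root per block, the zero block included, so this counts the roots lost since the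
    minimum. *)
Definition rank p : nat := n.+1 - #|roots p|.

Lemma card_roots p : 0 < #|roots p| <= n.+1.
Proof.
rewrite card_gt0; apply/andP; split; last by rewrite -[leqRHS]card_ord max_card.
by apply/set0Pn; exists ord0; apply: ord0_roots.
Qed.

Lemma rank_lt p q : (p < q)%O -> rank p < rank q.
Proof.
rewrite lt_neqAle => /andP[neq le_pq].
have /proper_card : roots q \proper roots p.
  rewrite properEneq roots_sub // andbT.
  by apply: contra neq => /eqP E; apply/eqP/roots_eq.
by rewrite /rank; have := card_roots p; have := card_roots q; lia.
Qed.

Lemma cover_root p q : (p <= q)%O -> rank q = (rank p).+1 ->
  exists r, [/\ r != ord0, r \in roots p & roots q = roots p :\ r].
Proof.
move=> le_pq rkE; have sub := roots_sub le_pq.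
have : #|roots p :\: roots q| = 1.
  rewrite cardsD (setIidPr sub); move: rkE; rewrite /rank.
  by have := card_roots p; have := card_roots q; lia.
move=> /eqP/cards1P[r E]; exists r.
have : r \in roots p :\: roots q by rewrite E inE.
rewrite inE => /andP[rq rp]; split=> //.
  by apply: contraNneq rq => ->; apply: ord0_roots.
by rewrite -E setDDr setDv set0U (setIidPr sub).
Qed.

Lemma merged_root p q r i j : roots q = roots p :\ r -> i \in roots p -> j \in roots p ->
  i != j -> same q i j -> (r == i) || (r == j).
Proof.
move=> E ip jp ij sij; apply: contraNT ij => /norP[ri rj].
apply/eqP; apply: (@roots_uniq q) => //; rewrite E in_setD1 eq_sym.
  by rewrite ri.
by rewrite rj.
Qed.

(** If all letters lie in the zero block, the empty maximum makes this [ord0]; the properties below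
    assume some letter outside. *)
Definition umax p : 'I_n.+1 := inord (\max_(i | ~~ same p ord0 i) (i : nat)).

Lemma umaxP p i : ~~ same p ord0 i ->
  ~~ same p ord0 (umax p) /\ (forall j, ~~ same p ord0 j -> j <= umax p).
Proof.
move=> nz; have c0 : 0 < #|[pred i | ~~ same p ord0 i]| by apply/card_gt0P; exists i.
have [u nzu Eu] := eq_bigmax_cond (fun i : 'I_n.+1 => i : nat) c0.
have Eum : umax p = u by rewrite /umax Eu inord_val.
rewrite Eum; split=> // j nzj.
have : j <= \max_(i : 'I_n.+1 | ~~ same p ord0 i) (i : nat) by apply: (bigop.bigmax_sup j).
by rewrite Eu.
Qed.

Lemma umax_root p i : ~~ same p ord0 i -> umax p \in roots p.
Proof.
move=> /umaxP[nz mx]; apply/(rootsP nz) => j uj; apply: mx.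
by rewrite -(same_congr_r _ uj).
Qed.

(** For [p <= q] the other inclusion between the two blocks is automatic. The steps for which this
    fails are the good ones. *)
Definition untouched p q : bool := [forall j, same q (umax p) j ==> same p (umax p) j].

(* Outside the untouched block, [q] is the restriction of [s]. *)
Lemma untouched_sub p q s i0 : ~~ same p ord0 i0 -> (p <= q)%O -> (q <= s)%O ->
  rank s = (rank q).+1 -> untouched p q -> ~~ untouched p s ->
  forall i j, same q i j =
    if same p (umax p) i then same p (umax p) j
    else ~~ same p (umax p) j && same s i j.
Proof.
set u := umax p => nz0 le_pq le_qs rkE /forallP uq us.
have [nzu mxu] := umaxP nz0; rewrite -/u in nzu mxu.
have qU i : same q u i = same p u i.
  by apply/idP/idP => [|]; [apply/implyP: (uq i)|apply: sp_le_sub].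
have up := umax_root nz0; rewrite -/u in up.
have nzuq : ~~ same q ord0 u by rewrite same_sym qU same_sym.
have uroot : u \in roots q by apply/(rootsP nzuq) => j; rewrite qU; apply: (rootsP nzu up).
have [r [r0 rq Er]] := cover_root le_qs rkE.
move: us; rewrite negb_forall => /existsP[k]; rewrite negb_imply => /andP[suk nuk].
have rootU i : (root q i == u) = same p u i.
  by rewrite -qU -{1}(root_id uroot) root_eq same_sym.
have sr i j : same s i j -> same s (root q i) (root q j).
  rewrite (same_congr _ (sp_le_sub le_qs (same_root q i))).
  by rewrite (same_congr_r _ (sp_le_sub le_qs (same_root q j))).
move=> i j; rewrite -(qU i) -(qU j); case: ifP => ui.
  by rewrite -(same_congr _ ui).
have [uj|nuj] /= := boolP (same q u j).
  by apply: contraFF ui => ij; rewrite (same_congr_r _ ij) uj.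
(* [s] already merges the block of [u] with that of [k] and loses only one root. If the blocks of
   [i] and [j] merged too, that root would be shared by both mergings, three blocks would be joined
   and two roots lost. *)
apply/idP/idP => [|sij]; first exact: sp_le_sub.
rewrite -root_eq; apply/negPn/negP => nij.
have riu : root q i != u by rewrite rootU -qU ui.
have rju : root q j != u by rewrite rootU -qU.
have rku : u != root q k by rewrite eq_sym rootU.
have suk' : same s u (root q k) by rewrite -{1}(root_id uroot); apply: sr.
have := merged_root Er uroot (root_in q k) rku suk'.
have M := merged_root Er (root_in q i) (root_in q j) nij (sr _ _ sij).
have ru : r != u by apply: contraTneq M => ->; rewrite ![u == _]eq_sym negb_or riu.
move: M; rewrite (negbTE ru) /= => /orP[]/eqP rE /eqP rk; move: nij; rewrite -?rE.
  move=> nij; have : same s u (root q j).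
    by apply: same_trans suk' _; rewrite -rk rE; apply: sr.
  move=> /(merged_root Er uroot (root_in q j)); rewrite eq_sym => /(_ rju).
  by rewrite (negbTE ru) /= (negbTE nij).
move=> nij; have : same s u (root q i).
  by apply: same_trans suk' _; rewrite -rk rE same_sym; apply: sr.
move=> /(merged_root Er uroot (root_in q i)); rewrite eq_sym => /(_ riu).
by rewrite (negbTE ru) /= eq_sym (negbTE nij).
Qed.

(** The preceding description gives both elements the same blocks. Relative signs come from [p] on
    the untouched block and from [s] on the other nonzero blocks. *)
Lemma untouched_uniq p q q' s i0 : ~~ same p ord0 i0 ->
  (p <= q)%O -> (p <= q')%O -> (q <= s)%O -> (q' <= s)%O ->
  rank s = (rank q).+1 -> rank s = (rank q').+1 ->
  untouched p q -> untouched p q' -> ~~ untouched p s -> q = q'.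
Proof.
move=> nz0 pq pq' qs qs' rk rk' uq uq' us.
have Eq := untouched_sub nz0 pq qs rk uq us.
have Eq' := untouched_sub nz0 pq' qs' rk' uq' us.
have Z i j : same q i j = same q' i j by rewrite Eq Eq'.
have [nzu _] := umaxP nz0.
apply: sp_ext => // i j ij nzi; have := ij; rewrite Eq; case: ifP => ui.
  move=> uj; have pij : same p i j by rewrite -(same_congr _ ui).
  by rewrite -(sp_le_sg pq pij nzi) -(sp_le_sg pq' pij) // -Z.
have zu : same p (umax p) ord0 = false by apply: contraNF nzu; rewrite same_sym.
case/andP=> uj sij; have nzs : ~~ same s ord0 i.
  by apply: contra nzi => zi; rewrite Eq zu ui.
by rewrite (sp_le_sg qs ij nzs) (sp_le_sg qs' _ nzs) // -Z.
Qed.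

End SignedPartitionTheory.

(** * Splittings *)

Section Splittings.
Variable n : nat.
Implicit Types (p q : signed_partition n) (w : 'S_n) (e : {ffun 'I_n -> bool}).
Implicit Types (S : {set 'I_n}) (i j c : 'I_n).

Notation L w i := (lift ord0 (w i)).

Lemma letter_cases w (a : 'I_n.+1) : a = ord0 \/ exists i, a = L w i.
Proof.
case: (unliftP ord0 a) => [v ->|]; [right|by left].
by exists ((w^-1)%g v); rewrite permKV.
Qed.

Lemma L_inj w : injective (fun i => L w i).
Proof. by move=> i j /lift_inj /perm_inj. Qed.

Variant split_spec w e S : {set letter n} -> Prop :=
  | SplitZero : split_spec w e S (split_zero_block w S)
  | SplitNonzero c of c \in S : split_spec w e S (normalize (split_block w e S c)).

Lemma split_blockP w e S b : b \in blocks (splitting w e S) -> split_spec w e S b.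
Proof.
rewrite /= !inE => /orP[/eqP->|/imsetP[c cS ->]]; first exact: SplitZero.
exact: SplitNonzero.
Qed.

Lemma in_split_zero w S i s :
  ((L w i, s) \in split_zero_block w S) = ~~ s && [forall c in S, i < c].
Proof.
apply/idP/andP => [/in_zero_block[/(congr1 fst) //|[j jS E]]|[/negbTE -> iS]].
  have /lift_inj/perm_inj-> := congr1 fst E; have /= -> := congr1 snd E.
  by split=> //; apply/forall_inP.
by rewrite !inE; apply/orP; right; apply/imsetP; exists i; rewrite ?inE.
Qed.

Lemma in_split_block w e S c i s : ((L w i, s) \in split_block w e S c) =
  [&& s == e i, c <= i & [forall j in S, (c < j) ==> (i < j)]].
Proof.
apply/imsetP/andP => [[j + E]|[/eqP-> h]].
  have /lift_inj/perm_inj-> := congr1 fst E; have /= -> := congr1 snd E.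
  by rewrite inE eqxx => ->.
by exists i; rewrite ?inE.
Qed.

Lemma split_block_unbarred w e S c i s :
  ((L w i, s) \in normalize (split_block w e S c)) =
  [&& s == e i (+) ~~ min_unbarred (split_block w e S c),
      c <= i & [forall j in S, (c < j) ==> (i < j)]].
Proof.
rewrite /normalize; case: ifP => _; rewrite ?in_bar in_split_block ?addbF ?addbT //.
by congr (_ && _); case: s; case: (e i).
Qed.

(** The cut [c] sits just before position [c], so it separates [i] from [j] exactly when it is at
    most one of them. *)
Lemma same_split w e S i j :
  same (splitting w e S) (L w i) (L w j) = [forall c in S, (c <= i) == (c <= j)].
Proof.
apply/sameP/forall_inP => [[b /split_blockP[|c cS]]|h].
- rewrite !in_split_zero => -[/andP[_ /forall_inP iS] /andP[_ /forall_inP jS]] c cS.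
  by have := iS c cS; have := jS c cS; lia.
- rewrite !split_block_unbarred => -[/and3P[_ ci /forall_inP iS] /and3P[_ cj /forall_inP jS]].
  by move=> k kS; have := iS k kS; have := jS k kS; lia.
have [b bp ib] := block_of (splitting w e S) (L w i); exists b => //; split=> //.
have [s jb] : exists s, (L w j, s) \in b.
  case/split_blockP: bp ib => [|c cS].
    rewrite in_split_zero => /andP[_ /forall_inP iS]; exists false.
    rewrite in_split_zero /=; apply/forall_inP => k kS.
    by have := iS k kS; have /eqP := h k kS; lia.
  rewrite split_block_unbarred => /and3P[_ ci /forall_inP iS].
  exists (e j (+) ~~ min_unbarred (split_block w e S c)).
  rewrite split_block_unbarred eqxx /=; apply/andP; split.
    by have /eqP := h c cS; rewrite ci.
  by apply/forall_inP => k kS; have := iS k kS; have /eqP := h k kS; lia.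
by rewrite -(sg_block bp jb).
Qed.

Lemma same_split0 w e S i :
  same (splitting w e S) ord0 (L w i) = [forall c in S, i < c].
Proof.
have zb : split_zero_block w S \in blocks (splitting w e S) by rewrite /= setU11.
apply/sameP/idP => [[b bp [zb' ib]]|iS].
  move: zb' ib; rewrite sg0; case/split_blockP: bp => [|c cS].
    by rewrite in_split_zero => _ /andP[].
  by case/in_normalize=> j [_ _ /=] /esym/eqP; rewrite -val_eqE.
exists (split_zero_block w S) => //; rewrite sg0; split; first by rewrite setU11.
by rewrite sg_zero ?in_split_zero //; apply/sameP; exists (split_zero_block w S);
   rewrite // sg0; split; rewrite ?setU11 //; have := in_split_zero w S i false;
   rewrite iS => h; rewrite -(sg_block zb h).
Qed.

Lemma sg_split w e S i j (p := splitting w e S) : same p (L w i) (L w j) ->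
  ~~ same p ord0 (L w i) -> sg p (L w i) (+) sg p (L w j) = e i (+) e j.
Proof.
case/sameP=> b bp [ib jb]; rewrite same_split0 => nz.
case/split_blockP: bp ib jb => [|c cS].
  by rewrite in_split_zero (negbTE nz) andbF.
rewrite !split_block_unbarred => /and3P[/eqP-> _ _] /and3P[/eqP-> _ _].
by rewrite addbACA addbb addbF.
Qed.

(** For fixed [(w, e)] this is an equivalence relation on positions, monotone in [q]; it reduces
    comparisons with a splitting to adjacent positions. *)
Definition linked q w e i j : bool := same q (L w i) (L w j) &&
  (same q ord0 (L w i) || (sg q (L w i) (+) sg q (L w j) == e i (+) e j)).

Lemma linked_refl q w e i : linked q w e i i.
Proof. by rewrite /linked same_refl !addbb eqxx orbT. Qed.

Lemma linked_sym q w e i j : linked q w e i j = linked q w e j i.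
Proof.
rewrite /linked same_sym; have [ij /=|//] := boolP (same q (L w j) (L w i)).
by rewrite (same_congr_r _ ij) addbC (addbC (e i)).
Qed.

Lemma linked_trans q w e j i k : linked q w e i j -> linked q w e j k -> linked q w e i k.
Proof.
rewrite /linked => /andP[ij hij] /andP[jk hjk]; rewrite (same_trans ij jk) /=.
move: hjk hij; rewrite (same_congr_r _ ij); case: (same q ord0 _) => //= /eqP E2 /eqP E1.
by move: E1 E2; case: (sg q (L w i)); case: (sg q (L w j)); case: (sg q (L w k));
   case: (e i); case: (e j); case: (e k).
Qed.

Lemma linked_le p q w e i j : (p <= q)%O -> linked p w e i j -> linked q w e i j.
Proof.
move=> pq /andP[ij h]; rewrite /linked (sp_le_sub pq ij) /=.
have [//|/= nz] := boolP (same q ord0 (L w i)).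
rewrite -(sp_le_sg pq ij nz); case/orP: h => // zi.
by rewrite (sp_le_sub pq zi) in nz.
Qed.

Lemma linked_split w e S i j :
  linked (splitting w e S) w e i j = [forall c in S, (c <= i) == (c <= j)].
Proof.
rewrite /linked same_split; case: (boolP [forall c in S, _]) => //= h.
apply/orP; case: (boolP (same _ ord0 _)) => z; [by left|right].
by rewrite sg_split // same_split.
Qed.

Lemma split_linked w e S q :
  (forall i j, j = i.+1 :> nat -> j \notin S -> linked q w e i j) ->
  forall i j, i <= j -> (forall c, c \in S -> i < c -> j < c) -> linked q w e i j.
Proof.
move=> adj i; suff H m : forall j, j = i + m :> nat ->
    (forall c, c \in S -> i < c -> j < c) -> linked q w e i j.
  by move=> j ij; apply: (H (j - i)); lia.
elim: m => [|m IH] j jE cuts.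
  have -> : i = j by apply: val_inj; rewrite /= jE addn0.
  exact: linked_refl.
have lt_j : i + m < n by have := ltn_ord j; lia.
apply: (@linked_trans _ _ _ (Ordinal lt_j)).
  by apply: IH => // c cS ic /=; have := cuts c cS ic; lia.
apply: adj => /=; first by lia.
by apply/negP => /cuts; lia.
Qed.

(** A splitting is generated by its uncut adjacencies, the letter 0 standing just before position
    0. *)
Lemma split_le w e S q :
  (forall i j, j = i.+1 :> nat -> j \notin S -> linked q w e i j) ->
  (forall i, i = 0 :> nat -> i \notin S -> same q ord0 (L w i)) ->
  (splitting w e S <= q)%O.
Proof.
move=> adj adj0; have lk := split_linked adj.
have z i : same (splitting w e S) ord0 (L w i) -> same q ord0 (L w i).
  rewrite same_split0 => /forall_inP iS.
  have n0 : 0 < n by apply: leq_ltn_trans (ltn_ord i).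
  have z0 : same q ord0 (L w (Ordinal n0)).
    by apply: adj0 => //; apply/negP => /iS.
  apply: same_trans z0 _; suff /andP[] : linked q w e (Ordinal n0) i by [].
  by apply: lk => // c /iS.
have lks i j : same (splitting w e S) (L w i) (L w j) -> linked q w e i j.
  rewrite same_split => /forall_inP h; case: (leqP i j) => ij.
    by apply: lk => // c /h; lia.
  by rewrite linked_sym; apply: lk => [|c /h]; lia.
apply/sp_le_same => a b ab.
have zz a' : same (splitting w e S) ord0 a' -> same q ord0 a'.
  by case: (letter_cases w a') => [->|[i ->]]; [rewrite !same_refl|apply: z].
case: (letter_cases w a) ab => [->|[i ->]] ab.
  by split; [apply: zz|rewrite same_refl].
case: (letter_cases w b) ab => [->|[j ->]] ab.
  by rewrite [same q _ _]same_sym zz // same_sym.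
have /andP[ij h] := lks _ _ ab; split=> // nz; move: h; rewrite (negbTE nz) => /eqP->.
by apply: sg_split => //; apply: contra nz; apply: z.
Qed.

(** Each cut begins one nonzero block; the zero block accounts for the successor. *)
Lemma card_roots_split w e S : #|roots (splitting w e S)| = #|S|.+1.
Proof.
set p := splitting w e S; pose f c := root p (L w c).
have nzS c : c \in S -> ~~ same p ord0 (L w c).
  by move=> cS; rewrite same_split0; apply/forall_inP => /(_ c cS); rewrite ltnn.
have f_inj : {in S &, injective f}.
  move=> c c' cS c'S /eqP; rewrite root_eq same_split => /forall_inP h.
  by apply: val_inj; have := h c cS; have := h c' c'S; rewrite /= !leqnn; lia.
rewrite (cardsD1 ord0) ord0_roots add1n -(card_in_imset f_inj); congr (#|pred_of_set _|.+1).
apply/setP => r; rewrite !inE; apply/andP/imsetP => [[r0 /eqP rr]|[c cS ->]].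
  case: (letter_cases w r) r0 rr => [->|[i ->] _ rr]; first by rewrite eqxx.
  have : ~~ same p ord0 (L w i) by rewrite roots_zero // inE rr.
  rewrite same_split0 negb_forall => /existsP[c0]; rewrite negb_imply -leqNgt => c0P.
  have {}c0P : [pred c : 'I_n | (c \in S) && (c <= i)] c0 := c0P.
  case: (arg_maxnP (fun c : 'I_n => c : nat) c0P) => c /andP[cS ci] cmax.
  exists c => //; rewrite -[LHS]rr; apply/eqP; rewrite root_eq same_split.
  apply/forall_inP => k kS; case: (leqP k i) => ki.
    by have /= -> : geq c k by apply: cmax; rewrite /= kS.
  by rewrite leqNgt (leq_ltn_trans ci ki).
split; last by rewrite rootK.
apply: contra (nzS c cS) => /eqP E; rewrite same_sym.
by have := same_root p (L w c); rewrite -/(f c) E.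
Qed.

Lemma rank_split w e S : rank (splitting w e S) = n - #|S|.
Proof. by rewrite /rank card_roots_split subSS. Qed.

(** The permutation and signs chosen here and for [top] are immaterial, by [splitT] and
    [split_set0]. *)
Definition bot : signed_partition n := splitting 1%g [ffun=> false] setT.
Definition top : signed_partition n := splitting 1%g [ffun=> false] set0.

Lemma bot_le p : (bot <= p)%O.
Proof. by apply: split_le => [i j|i] _; rewrite inE. Qed.

Lemma same_split_set0 w e a : same (splitting w e set0) ord0 a.
Proof.
case: (letter_cases w a) => [->|[i ->]]; first exact: same_refl.
by rewrite same_split0; apply/forall_inP => c; rewrite inE.
Qed.

Lemma same_top a : same top ord0 a.
Proof. exact: same_split_set0. Qed.

Lemma le_top p : (p <= top)%O.
Proof.
apply/sp_le_same => a b _; rewrite same_top.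
by split=> //; apply: same_trans (same_top b); rewrite same_sym same_top.
Qed.

Lemma rank_bot : rank bot = 0.
Proof. by rewrite rank_split cardsT card_ord subnn. Qed.

Lemma rank_top : rank top = n.
Proof. by rewrite rank_split cards0 subn0. Qed.

Lemma splitT w e : splitting w e setT = bot.
Proof.
apply/le_anti; rewrite bot_le andbT.
by apply: split_le => [i j|i] _; rewrite inE.
Qed.

Lemma split_set0 w e : splitting w e set0 = top.
Proof.
have E p : (forall a, same p ord0 a) -> forall a b, same p a b.
  by move=> z a b; rewrite -(same_congr _ (z a)).
apply: sp_ext => a b; last by rewrite same_split_set0.
by rewrite (E _ same_top) (E _ (same_split_set0 w e)).
Qed.

Lemma in_PiD p : (p \in PiD n) = (#|[set a | same p ord0 a]| != 2).
Proof.
have [b bp zb] := block_of p ord0; rewrite sg0 in zb.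
have E : #|b| = #|[set a | same p ord0 a]|.
  have inj : injective (fun a : 'I_n.+1 => (a, false)) by move=> ? ? [].
  rewrite -(card_imset _ inj).
  apply: eq_card => -[a s]; apply/idP/imsetP => [ab|[a' + [-> ->]]].
    have za : same p ord0 a.
      by apply/sameP; exists b; rewrite // sg0 -(sg_block bp ab).
    by exists a; rewrite ?inE // (sg_block bp ab) sg_zero.
  rewrite inE => za; have /sameP[c cp []] := za; rewrite sg0 (sg_zero za) => zc.
  by have [-> _] := sp_uniq bp cp zb zc.
rewrite inE -E; apply/forall_inP/idP => [/(_ b bp)|h c cp]; first by rewrite zb.
by apply/implyP => zc; have [<- _] := sp_uniq bp cp zb zc.
Qed.

End Splittings.

(** * Segments of a permutation *)

Section Segments.
Variable n : nat.
Implicit Types (w s : 'S_n) (i j c : 'I_n).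

(** The fixed points are the right-to-left maxima, and the fibres are the intervals ending at them:
    the segments of [w]. *)
Definition seg_end w i : 'I_n := [arg max_(j > i | i <= j) (w j : nat)].

Lemma seg_endP w i : i <= seg_end w i /\ (forall j, i <= j -> w j <= w (seg_end w i)).
Proof. by rewrite /seg_end; case: arg_maxnP => // j ij mj; split=> // k /mj. Qed.

Lemma seg_end_ge w i : i <= seg_end w i.
Proof. by case: (seg_endP w i). Qed.

Lemma seg_end_max w i j : i <= j -> w j <= w (seg_end w i).
Proof. by case: (seg_endP w i) => _; apply. Qed.

Lemma seg_end_uniq w i c : i <= c -> (forall j, i <= j -> w j <= w c) -> seg_end w i = c.
Proof.
move=> ic mc; apply: (@perm_inj _ w); apply/val_inj/eqP.
by rewrite eqn_leq mc ?seg_end_ge // seg_end_max.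
Qed.

Lemma seg_end_eq w i j : i <= j -> j <= seg_end w i -> seg_end w j = seg_end w i.
Proof.
move=> ij je; apply: seg_end_uniq => // k jk.
by apply: seg_end_max; apply: leq_trans jk.
Qed.

Lemma seg_endK w i : seg_end w (seg_end w i) = seg_end w i.
Proof. by apply: seg_end_eq => //; apply: seg_end_ge. Qed.

Lemma seg_end_mono w i j : i <= j -> seg_end w i <= seg_end w j.
Proof.
move=> ij; case: (leqP j (seg_end w i)) => h; first by rewrite (seg_end_eq ij h).
exact: leq_trans (ltnW h) (seg_end_ge _ _).
Qed.

Lemma rtl_maxE w i : rtl_max w i = (seg_end w i == i).
Proof.
apply/forallP/eqP => [h|h j]; last first.
  apply/implyP => ij; rewrite ltn_neqAle; apply/andP; split.
    apply: contraTneq ij => /val_inj/perm_inj ->; by rewrite ltnn.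
  by rewrite -[in leqRHS]h; apply/seg_end_max/ltnW.
apply: seg_end_uniq => // j; rewrite leq_eqVlt => /predU1P[/val_inj->//|ij].
by apply: ltnW; apply: (implyP (h j)).
Qed.

Definition seg_start w i : 'I_n := [arg min_(j < i | seg_end w j == seg_end w i) (j : nat)].

Lemma seg_startP w i : seg_end w (seg_start w i) = seg_end w i /\
  (forall j, seg_end w j = seg_end w i -> seg_start w i <= j).
Proof.
by rewrite /seg_start; case: arg_minnP => // j /eqP ej mj; split=> // k /eqP /mj.
Qed.

Lemma seg_start_le w i : seg_start w i <= i.
Proof. by case: (seg_startP w i) => _; apply. Qed.

Lemma seg_end_start w i : seg_end w (seg_start w i) = seg_end w i.
Proof. by case: (seg_startP w i). Qed.

Lemma seg_start_eq w i j : seg_end w i = seg_end w j -> seg_start w i = seg_start w j.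
Proof.
move=> E; have [h1 h2] := seg_startP w i; have [h3 h4] := seg_startP w j.
by apply/val_inj/eqP; rewrite eqn_leq h2 ?h4 ?h1 ?h3.
Qed.

Lemma in_seg w i j : seg_start w i <= j -> j <= seg_end w i -> seg_end w j = seg_end w i.
Proof.
move=> sj je; rewrite -(seg_end_start w i); apply: seg_end_eq => //.
by rewrite seg_end_start.
Qed.

Lemma seg_next w i j : seg_end w i < j -> seg_end w i < seg_start w j.
Proof.
move=> ij; rewrite ltnNge; apply/negP => h.
have : seg_end w (seg_end w i) = seg_end w j.
  by apply: in_seg => //; apply: leq_trans (ltnW ij) (seg_end_ge w j).
by rewrite seg_endK => E; have := seg_end_ge w j; rewrite -E leqNgt ij.
Qed.

Lemma seg_lt w i j : seg_end w i < seg_end w j -> seg_end w i < j.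
Proof.
by move=> h; rewrite ltnNge; apply/negP => /(seg_end_mono w); rewrite seg_endK leqNgt h.
Qed.

Lemma cut_time_proof w i : seg_start w i + seg_end w i - i < n.
Proof.
have := seg_start_le w i; have := ltn_ord (seg_end w i); lia.
Qed.

(* The step at which the cut at position [i] is removed: segments are treated
   from left to right, the cuts of a segment from right to left. *)
Definition cut_time w i : 'I_n := Ordinal (cut_time_proof w i).

Lemma cut_time_end w i : seg_end w (cut_time w i) = seg_end w i.
Proof.
have h1 := seg_start_le w i; have h2 := seg_end_ge w i.
by apply: in_seg => /=; lia.
Qed.

Lemma cut_timeK w : involutive (cut_time w).
Proof.
move=> i; apply: val_inj => /=; rewrite cut_time_end (seg_start_eq (cut_time_end w i)).
have h1 := seg_start_le w i; have h2 := seg_end_ge w i; lia.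
Qed.

Lemma cut_time_start w i : cut_time w (seg_start w i) = seg_end w i.
Proof.
apply: val_inj; rewrite /= seg_end_start (seg_start_eq (seg_end_start w i)).
by rewrite addKn.
Qed.

(** Removing the cut at [i.+1] joins position [i] to the block of its segment end, whence the shift
    by one. The end itself goes last, together with the cut at the segment start. *)
Lemma letter_time_proof w i :
  (if i == seg_end w i then i : nat else seg_start w i + seg_end w i - i.+1) < n.
Proof.
case: ifP => _; first exact: ltn_ord.
have := seg_start_le w i; have := ltn_ord (seg_end w i); lia.
Qed.

(* The step at which the letter at position [i] ceases to be a root. *)
Definition letter_time w i : 'I_n := Ordinal (letter_time_proof w i).

Lemma letter_time_end w i : seg_end w (letter_time w i) = seg_end w i.
Proof.
have h1 := seg_start_le w i; have h2 := seg_end_ge w i.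
apply: in_seg => /=; case: eqP => [//|h].
- have : i != seg_end w i :> nat by apply/eqP => /val_inj. lia.
- lia.
Qed.

Lemma letter_timeE w i : i != seg_end w i ->
  letter_time w i = seg_start w i + seg_end w i - i.+1 :> nat.
Proof. by move=> h /=; rewrite (negbTE h). Qed.

Lemma letter_time_id w i : letter_time w (seg_end w i) = seg_end w i.
Proof. by apply: val_inj => /=; rewrite seg_endK eqxx. Qed.

Lemma letter_time_lt w i : i != seg_end w i -> letter_time w i < seg_end w i.
Proof.
move=> h; rewrite letter_timeE //.
have h1 := seg_start_le w i; have h2 := seg_end_ge w i.
have : i != seg_end w i :> nat by []. lia.
Qed.

Lemma letter_timeK w : involutive (letter_time w).
Proof.
move=> i; have [E|h] := eqVneq i (seg_end w i).
  by rewrite E !letter_time_id.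
apply: val_inj; change (letter_time w (letter_time w i) = i :> nat).
rewrite letter_timeE letter_time_end; last first.
  by rewrite -val_eqE ltn_eqF // letter_time_lt.
rewrite (seg_start_eq (letter_time_end w i)) letter_timeE //.
have h1 := seg_start_le w i; have h2 := seg_end_ge w i.
have : i != seg_end w i :> nat by []. lia.
Qed.

Definition letter_perm w : 'S_n := perm (can_inj (letter_timeK w)).

(** Rearranging letters inside segments while keeping each segment end in place does not move the
    suffix maxima. *)
Lemma seg_end_reindex w s : (forall i, seg_end w (s i) = seg_end w i) ->
  (forall i, s (seg_end w i) = seg_end w i) ->
  forall i, seg_end (s * w)%g i = seg_end w i.
Proof.
move=> es se i; apply: seg_end_uniq; first exact: seg_end_ge.
move=> j ij; rewrite !permM se.
case: (leqP i (s j)) => [isj|sji]; first exact: seg_end_max.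
have E : seg_end w j = seg_end w i.
  apply/val_inj/eqP; rewrite eqn_leq (seg_end_mono w ij) andbT.
  by rewrite -(es j) seg_end_mono // ltnW.
by rewrite -E -(es j); apply: seg_end_max.
Qed.

Lemma seg_start_congr w s : (forall i, seg_end s i = seg_end w i) ->
  forall i, seg_start s i = seg_start w i.
Proof.
move=> E i; have [h1 h2] := seg_startP s i; have [h3 h4] := seg_startP w i.
by apply/val_inj/eqP; rewrite eqn_leq h2 ?h4 -?E ?h1 ?E ?h3.
Qed.

Lemma letter_time_congr w s : (forall i, seg_end s i = seg_end w i) ->
  forall i, letter_time s i = letter_time w i.
Proof. by move=> E i; apply: val_inj => /=; rewrite E (seg_start_congr E). Qed.

Definition cuts w (k : nat) : {set 'I_n} := [set i | k <= cut_time w i].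

Lemma card_cuts w k : #|cuts w k| = n - k.
Proof.
have -> : cuts w k = cut_time w @: [set i : 'I_n | k <= i].
  apply/setP => i; rewrite inE; apply/idP/imsetP => [ki|[j + ->]].
    by exists (cut_time w i); rewrite ?inE ?cut_timeK.
  by rewrite inE cut_timeK.
rewrite card_imset; last exact: can_inj (cut_timeK w).
rewrite -sum1_card -[RHS]muln1 -sum_nat_const_nat.
rewrite (eq_bigl (fun i : 'I_n => k <= i)); last by move=> i; rewrite inE.
by rewrite big_geq_mkord.
Qed.

Lemma cuts0 w : cuts w 0 = setT.
Proof. by apply/setP => i; rewrite !inE. Qed.

Lemma cutsn w : cuts w n = set0.
Proof. by apply/setP => i; rewrite !inE leqNgt ltn_ord. Qed.

(** Here positions 0 and 1 share the first segment, so the cut at 1 is removed before the cut at 0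
    and is never the smallest one left. The unshifted 1 of the splitting positions is the 1 used
    here. *)
Lemma cuts_admissible w k : (forall i, i = 0 :> nat -> seg_end w i != i) ->
  admissible (cuts w k).
Proof.
move=> h0; apply/forall_inP => i; rewrite inE => ki; apply/implyP => /forall_inP mi.
apply/eqP => i1; have lt0 : 0 < n by apply: leq_ltn_trans (ltn_ord i).
set z := Ordinal lt0.
have e0 : 0 < seg_end w z.
  by rewrite lt0n; apply: contra (h0 z erefl) => /eqP E; apply/eqP/val_inj.
have Ei : seg_end w i = seg_end w z by apply: seg_end_eq; rewrite /= ?i1.
have sz : seg_start w z = z by apply/val_inj/eqP; rewrite /= -leqn0 seg_start_le.
have /mi : z \in cuts w k.
  rewrite inE /=; apply: leq_trans ki _; rewrite /= (seg_start_eq Ei) Ei.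
  by apply: leq_sub2l; rewrite i1.
by rewrite i1.
Qed.

End Segments.

(** * Flags with only good steps *)

Section GoodFlags.
Variable n : nat.
Hypothesis n_ge2 : 2 <= n.
Implicit Types (p q : signed_partition n) (w : 'S_n) (e : {ffun 'I_n -> bool}).
Implicit Types (S : {set 'I_n}) (i j c : 'I_n).

Notation L w i := (lift ord0 (w i)).

Lemma split_sub w e S S' : S' \subset S -> (splitting w e S <= splitting w e S')%O.
Proof.
clear n_ge2; move=> /subsetP sub; apply: split_le => [i j ij jS|i i0 iS].
  rewrite linked_split; apply/forall_inP => c /sub cS.
  by have : c != j :> nat by [apply: contraNneq jS => /val_inj <-]; lia.
rewrite same_split0; apply/forall_inP => c /sub cS.
rewrite i0 lt0n; apply: contraNneq iS => c0; rewrite (_ : i = c) //.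
by apply: val_inj; rewrite /= i0.
Qed.

(** A zero block of size 2 contains just one letter of [w], which forces the smallest cut to be at
    position 1. *)
Lemma admissible_PiD w e S : admissible S -> splitting w e S \in PiD n.
Proof.
move=> /forall_inP adm; rewrite in_PiD; apply/eqP => card2.
have lt0 : 0 < n by lia.
pose i0 : 'I_n := Ordinal lt0; pose i1 : 'I_n := Ordinal n_ge2.
pose z i := same (splitting w e S) ord0 (L w i).
have zS i : z i -> forall c, c \in S -> i < c by rewrite /z same_split0 => /forall_inP.
have card1 : #|[set i | z i]| = 1.
  have := card2; rewrite (cardsD1 ord0) inE same_refl add1n => -[] <-.
  rewrite -(card_imset (pred_of_set [set i | z i]) (f := fun i => L w i)); last exact: L_inj.
  apply: eq_card => a; apply/imsetP/setD1P => [[i + ->]|[]].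
    by rewrite !inE => zi; split.
  move=> h; rewrite inE; case: (letter_cases w a) h => [->|[i ->] _ zi]; first by rewrite eqxx.
  by exists i; rewrite ?inE.
move/eqP/cards1P: card1 => [i E].
have zi : z i by have := set11 i; rewrite -E inE.
have z0 : z i0.
  rewrite /z same_split0; apply/forall_inP => c cS.
  exact: leq_ltn_trans (zS i zi c cS).
have Ei : i0 = i by apply/set1P; rewrite -E inE.
have : ~~ z i1.
  apply/negP => z1; have : i1 = i by apply/set1P; rewrite -E inE.
  by rewrite -Ei => /(congr1 val).
rewrite /z same_split0 negb_forall => /existsP[c]; rewrite negb_imply -leqNgt => /andP[cS c1].
have c0 := zS i0 z0; have cE : c = 1 :> nat by have := c0 c cS; rewrite /= in c1 *; lia.
have /implyP := adm c cS; rewrite cE => h; have : 1 != 1 by apply: h; apply/forall_inP => d /c0.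
by [].
Qed.

Lemma admissible_set0 : admissible (set0 : {set 'I_n}).
Proof. by apply/forall_inP => i; rewrite inE. Qed.

Lemma admissible_setT : admissible (setT : {set 'I_n}).
Proof.
apply/forall_inP => i _; apply/implyP => /forall_inP mi; apply/eqP => i1.
by have := mi (Ordinal (ltnW n_ge2)) (in_setT _); rewrite i1.
Qed.

Lemma bot_PiD : bot n \in PiD n.
Proof. exact/admissible_PiD/admissible_setT. Qed.

Lemma top_PiD : top n \in PiD n.
Proof. exact/admissible_PiD/admissible_set0. Qed.

Lemma graded_PiD : graded (PiD n) n (@rank n) (bot n) (top n).
Proof.
split=> //; [exact: rank_lt|exact: bot_PiD|exact: top_PiD|exact: bot_le|exact: le_top| |].
  exact: rank_bot.
exact: rank_top.
Qed.

(** The flag written [m_x] in the overview, for [x] given by [(w, e)]. *)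
Definition mflag w e (k : nat) : signed_partition n := splitting w e (cuts w k).

Lemma mflag_rank w e k : k <= n -> rank (mflag w e k) = k.
Proof. by move=> kn; rewrite rank_split card_cuts subKn. Qed.

Lemma mflag_flag (B : {set signed_partition n}) w e :
  (forall i, i = 0 :> nat -> seg_end w i != i) ->
  (forall S, admissible S -> splitting w e S \in B) ->
  flag B n (bot n) (top n) (mflag w e).
Proof.
move=> h0 inB; split=> [k _|k kn||].
- exact/inB/cuts_admissible.
- rewrite lt_neqAle; apply/andP; split.
    by apply/eqP => /(congr1 (@rank n)); rewrite !mflag_rank ?(ltnW kn) //; lia.
  by apply/split_sub/subsetP => i; rewrite !inE; apply: ltnW.
- by rewrite /mflag cuts0 splitT.
- by rewrite /mflag cutsn split_set0.
Qed.

(** The position of the root of the block containing the letter at [i] after [k] steps, [None]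
    standing for the zero block. *)
Definition rep w (k : nat) i : option 'I_n :=
  if k <= letter_time w i then Some i
  else if k <= seg_end w i then Some (seg_end w i) else None.

Lemma letter_time_le w i : letter_time w i <= seg_end w i.
Proof.
have [E|/letter_time_lt/ltnW//] := eqVneq i (seg_end w i).
by rewrite {1}E letter_time_id.
Qed.

Lemma rep_None w k i : (rep w k i == None) = (seg_end w i < k).
Proof.
rewrite /rep; case: ifP => h; last by case: leqP.
by symmetry; apply/negbTE; rewrite -leqNgt; apply: leq_trans h (letter_time_le _ _).
Qed.

Lemma mflag_zero w e k i : same (mflag w e k) ord0 (L w i) = (rep w k i == None).
Proof.
rewrite rep_None same_split0; apply/forall_inP/idP => [h|ek c].
  rewrite ltnNge; apply/negP => ke; have : seg_start w i \in cuts w k.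
    by rewrite inE cut_time_start.
  by move/h; rewrite ltnNge seg_start_le.
rewrite inE => kc; apply: leq_ltn_trans (seg_end_ge w i) _; apply: seg_lt.
by apply: leq_trans ek (leq_trans kc _); rewrite -(cut_time_end w c) seg_end_ge.
Qed.

Lemma mflag_linked_end w e k i : letter_time w i < k -> k <= seg_end w i ->
  linked (mflag w e k) w e i (seg_end w i).
Proof.
clear n_ge2; move=> lk ke; have ni : i != seg_end w i.
  by apply: contraTneq lk => E; rewrite -leqNgt {1}E letter_time_id.
rewrite linked_split; apply/forall_inP => c; rewrite inE => kc.
case: (leqP c i) => ci; first by rewrite (leq_trans ci (seg_end_ge w i)).
rewrite eq_sym; apply/eqP/negbTE; rewrite -ltnNge ltnNge; apply/negP => ce.
have Ec := seg_end_eq (ltnW ci) ce.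
move: kc lk; rewrite letter_timeE //= Ec (seg_start_eq Ec).
by have := seg_start_le w i; have := seg_end_ge w i; lia.
Qed.

Lemma mflag_linked_rep w e k i j : rep w k i = Some j -> linked (mflag w e k) w e i j.
Proof.
rewrite /rep; case: leqP => [_ [<-]|lk]; first exact: linked_refl.
by case: leqP => // ke [<-]; apply: mflag_linked_end.
Qed.

Lemma rep_time w k i j : rep w k i = Some j -> k <= letter_time w j.
Proof.
rewrite /rep; case: leqP => [h [<-]//|_].
by case: leqP => // ke [<-]; rewrite letter_time_id.
Qed.

Lemma rep_separated w e k i j : k <= letter_time w i -> k <= letter_time w j ->
  same (mflag w e k) (L w i) (L w j) -> i = j.
Proof.
wlog ij : i j / i <= j => [wl ki kj sij|ki kj].
  case: (leqP i j) => [|/ltnW] ij; first exact: wl.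
  by apply/esym/wl => //; rewrite same_sym.
rewrite same_split => /forall_inP h; apply/val_inj/eqP.
rewrite eqn_leq ij leqNgt; apply/negP => lij.
(* The separating cut is the start of the segment of [j] if [i] ends its own segment, and [i.+1]
   otherwise. *)
suff [c [cc ic cj]] : exists c, [/\ c \in cuts w k, i < c & c <= j].
  by have := h c cc; rewrite cj leqNgt ic.
have [E|ne] := eqVneq i (seg_end w i).
  exists (seg_start w j); rewrite seg_start_le inE cut_time_start; split=> //.
    exact: leq_trans kj (letter_time_le _ _).
  by rewrite E; apply: seg_next; rewrite -E.
have ie : i.+1 <= seg_end w i by rewrite ltn_neqAle ne seg_end_ge.
have i1n : i.+1 < n by apply: leq_ltn_trans (ltn_ord (seg_end w i)).
exists (Ordinal i1n); split=> //; rewrite inE /=.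
have E : seg_end w (Ordinal i1n) = seg_end w i by apply: seg_end_eq.
by move: ki; rewrite letter_timeE // E (seg_start_eq E).
Qed.

Lemma mflag_same w e k i j :
  same (mflag w e k) (L w i) (L w j) = (rep w k i == rep w k j).
Proof.
case Ei: (rep w k i) => [r|]; last first.
  have zi : same (mflag w e k) ord0 (L w i) by rewrite mflag_zero Ei.
  by rewrite -(same_congr _ zi) mflag_zero eq_sym.
case Ej: (rep w k j) => [r'|]; last first.
  have zj : same (mflag w e k) ord0 (L w j) by rewrite mflag_zero Ej.
  by rewrite -(same_congr_r _ zj) same_sym mflag_zero Ei.
have /andP[sir _] := mflag_linked_rep e Ei; have /andP[sjr _] := mflag_linked_rep e Ej.
rewrite (same_congr _ sir) (same_congr_r _ sjr); apply/idP/eqP => [h|[->]].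
  by congr Some; apply: (rep_separated (rep_time Ei) (rep_time Ej) h).
exact: same_refl.
Qed.

(** Signs need comparing only between a letter and its segment end, since all other links within a
    block pass through that end. *)
Lemma mflag_ext w e k p :
  (forall i, same p ord0 (L w i) = (rep w k i == None)) ->
  (forall i j, same p (L w i) (L w j) = (rep w k i == rep w k j)) ->
  (forall i, letter_time w i < k -> k <= seg_end w i -> linked p w e i (seg_end w i)) ->
  p = mflag w e k.
Proof.
move=> p0 ps pl; apply: sp_ext => a b.
  case: (letter_cases w a) => [->|[i ->]]; case: (letter_cases w b) => [->|[j ->]].
  - by rewrite !same_refl.
  - by rewrite p0 mflag_zero.
  - by rewrite !(same_sym _ _ ord0) p0 mflag_zero.
  - by rewrite ps mflag_same.
case: (letter_cases w a) => [->|[i ->]]; first by rewrite same_refl.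
case: (letter_cases w b) => [->|[j ->]]; first by rewrite same_sym => ->.
move=> sij nz; have nz' := nz; rewrite p0 in nz'.
have mij : same (mflag w e k) (L w i) (L w j) by rewrite mflag_same -ps.
rewrite [RHS](sg_split mij) ?mflag_zero //.
suff /andP[_] : linked p w e i j by rewrite (negbTE nz) => /eqP.
have lr c r : rep w k c = Some r -> linked p w e c r.
  rewrite /rep; case: leqP => [_ [<-]|lk]; first exact: linked_refl.
  by case: leqP => // ke [<-]; apply: pl.
move: nz' sij; rewrite ps; case Ei: (rep w k i) => [r|] // _ /eqP/esym Ej.
by apply: linked_trans (lr _ _ Ei) _; rewrite linked_sym; apply: lr.
Qed.

Definition good (F : nat -> signed_partition n) k := ~~ untouched (F k) (F k.+1).

(** The order in which roots are lost is a permutation [rho]. Goodness forces each lost root into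
    the block of the largest remaining letter, or into the zero block if it is that letter itself.
    Reordering [rho] inside its segments then yields [w]. *)
Lemma good_flag_mflag F : flag (PiD n) n (bot n) (top n) F ->
  (forall k, k < n -> good F k) ->
  exists w e, [/\ forall k, k <= n -> F k = mflag w e k,
    forall i, seg_end w i = i -> e i = false &
    forall i, i = 0 :> nat -> seg_end w i != i].
Proof.
move=> flF gF.
have rkF k : k <= n -> rank (F k) = k.
  exact: (flag_rk graded_PiD).
have leF k l : k <= l -> l <= n -> (F k <= F l)%O by apply: flag_le flF.
have /fin_all_exists[r rP] : forall k : 'I_n, exists r,
    [/\ r != ord0, r \in roots (F k) & roots (F k.+1) = roots (F k) :\ r].
  move=> k; apply: cover_root; first by apply: leF.
  by rewrite !rkF // ltnW.
have r_late (k : 'I_n) l : k < l -> l <= n -> r k \notin roots (F l).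
  move=> kl ln; have [_ _ E] := rP k; apply/negP => /(subsetP (roots_sub (leF _ _ kl ln))).
  by rewrite E !inE eqxx.
have r_early (k : 'I_n) l : l <= k -> r k \in roots (F l).
  by move=> lk; have [_ + _] := rP k; apply/subsetP/roots_sub/leF => //; apply: ltnW.
have r_inj : injective r.
  move=> k l E; apply/val_inj/eqP; rewrite eqn_leq; apply/andP.
  split; rewrite leqNgt.
    by apply/negP => lk; have := r_late l k lk (ltnW (ltn_ord k)); rewrite -E r_early.
  by apply/negP => kl; have := r_late k l kl (ltnW (ltn_ord l)); rewrite E r_early.
have /fin_all_exists[v vP] : forall k : 'I_n, exists v, r k = lift ord0 v.
  by move=> k; have [r0 _ _] := rP k; case: (unliftP ord0 (r k)) r0 => [v ->|->//] _; exists v.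
have v_inj : injective v by move=> k l E; apply: r_inj; rewrite !vP E.
pose rho : 'S_n := perm v_inj.
have rE k : L rho k = r k by rewrite permE vP.
have rootsF k l : l <= n -> (L rho k \in roots (F l)) = (l <= k).
  move=> ln; rewrite rE; case: leqP => [|kl]; first exact: r_early.
  by apply/negbTE/r_late.
have nzF (k : 'I_n) l : l <= k -> ~~ same (F l) ord0 (L rho k).
  by move=> lk; rewrite roots_zero // rootsF // (leq_trans lk) // ltnW.
(* The letters lost from step [k] on are the nonzero roots of [F k], and the largest of them is the
   suffix maximum of [rho]. *)
have umaxF (k : 'I_n) : umax (F k) = L rho (seg_end rho k).
  have nzk := nzF k k (leqnn _); have [nzu mu] := umaxP nzk.
  have ur := umax_root nzk.
  case: (letter_cases rho (umax (F k))) nzu => [->|[l El] _].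
    by rewrite same_refl.
  have kl : k <= l by rewrite -(rootsF l k) ?(ltnW (ltn_ord k)) // -El.
  have := mu _ (nzF (seg_end rho k) k (seg_end_ge _ _)); rewrite El /= !ltnS => h.
  have h' := seg_end_max rho kl.
  congr lift; apply/val_inj/eqP; rewrite eqn_leq h'.
  exact: h.
(* Outside the zero block the lost root would have a larger root, contrary to its being the largest
   one left. *)
have G1 (k : 'I_n) : seg_end rho k = k -> same (F k.+1) ord0 (L rho k).
  move=> ek; apply: contraT => nz.
  have nr : L rho k \notin roots (F k.+1) by rewrite rootsF // ltnn.
  have rm := root_max nz (same_refl _ _); have rin := root_in (F k.+1) (L rho k).
  have srt := same_root (F k.+1) (L rho k).
  case: (letter_cases rho (root (F k.+1) (L rho k))) => [E|[l E]]; move: rm rin srt; rewrite E.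
    by rewrite same_sym (negbTE nz).
  rewrite rootsF // => kl lk _; have := seg_end_max rho (ltnW lk); rewrite ek => h.
  have /perm_inj Ekl : rho l = rho k by apply/val_inj/eqP; rewrite eqn_leq h; apply: kl.
  by move: lk; rewrite Ekl ltnn.
(* The block of the largest letter takes part in the merging and keeps its root, so the lost root is
   that of its partner. *)
have G2 (k : 'I_n) : k != seg_end rho k -> same (F k.+1) (L rho k) (L rho (seg_end rho k)).
  move=> ke; have kle : k < seg_end rho k by rewrite ltn_neqAle ke seg_end_ge.
  have := gF k (ltn_ord k); rewrite /good negb_forall umaxF => /existsP[a].
  rewrite negb_imply => /andP[sa nsa].
  have nze := nzF (seg_end rho k) k.+1 kle.
  have su : same (F k.+1) (L rho (seg_end rho k)) (root (F k) a).
    by apply: same_trans sa _; apply: sp_le_sub (same_root _ _); apply: leF.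
  have nu : L rho (seg_end rho k) != root (F k) a.
    by apply: contra nsa => /eqP ->; rewrite same_sym same_root.
  have uin : L rho (seg_end rho k) \in roots (F k) by rewrite rootsF // ?(ltnW kle) // ltnW.
  have [_ _ Er] := rP k.
  have := merged_root Er uin (root_in _ _) nu su; rewrite -rE.
  have -> /= : (L rho k == L rho (seg_end rho k)) = false.
    by apply: contraNF ke => /eqP/L_inj <-.
  by move=> /eqP E; move: su; rewrite -E same_sym.
have rootF (k : 'I_n) l : l <= n -> root (F l) (L rho k) =
    if l <= k then L rho k else if l <= seg_end rho k then L rho (seg_end rho k) else ord0.
  move=> ln; case: leqP => [lk|kl]; first by rewrite root_id // rootsF.
  case: leqP => [le|el].
    have ke : k != seg_end rho k by apply: contraTneq kl => ->; rewrite -leqNgt.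
    have er : L rho (seg_end rho k) \in roots (F l) by rewrite rootsF.
    rewrite -[RHS](root_id er); apply/eqP; rewrite root_eq.
    by apply: sp_le_sub (G2 k ke); apply: leF.
  apply/eqP; rewrite -[X in _ == X](root0 (F l)) root_eq same_sym.
  have z1 : same (F l) ord0 (L rho (seg_end rho k)).
    by apply: sp_le_sub (G1 _ (seg_endK rho k)); apply: leF.
  apply: same_trans z1 _; have [E|ke] := eqVneq k (seg_end rho k).
    by rewrite -E same_refl.
  by rewrite same_sym; apply: sp_le_sub (G2 k ke); apply: leF.
(* The letter lost at step [k] is placed at the position whose [letter_time] is [k]; segments and
   their ends are unchanged. *)
pose pi := letter_perm rho.
have piE i : pi i = letter_time rho i by rewrite permE.
have endw : forall i, seg_end (pi * rho)%g i = seg_end rho i.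
  apply: seg_end_reindex => i; rewrite piE; first exact: letter_time_end.
  exact: letter_time_id.
set w := (pi * rho)%g in endw.
have timew := letter_time_congr endw.
have wE i : w i = rho (letter_time rho i) by rewrite permM piE.
have wend i : w (seg_end rho i) = rho (seg_end rho i) by rewrite wE letter_time_id.
(* The sign of a letter relative to its segment end, read off right after the step that joins them;
   the ends are left unbarred. *)
pose e : {ffun 'I_n -> bool} := [ffun i => let k := letter_time rho i in
  (i != seg_end rho i) && (sg (F k.+1) (L rho k) (+) sg (F k.+1) (L rho (seg_end rho k)))].
have rootw i l : l <= n -> root (F l) (L w i) =
    if rep w l i is Some j then L w j else ord0.
  move=> ln; rewrite wE rootF // /rep timew endw letter_time_end.
  case: leqP => _; first by rewrite wE.
  by case: leqP => _; rewrite ?wend.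
have zerow i l : l <= n -> same (F l) ord0 (L w i) = (rep w l i == None).
  move=> ln; rewrite -root_eq root0 rootw //; case: (rep w l i) => [j|//].
  by apply/eqP => /(congr1 val).
exists w, e; split.
- move=> l ln; apply: mflag_ext => [i|i j|i].
  + exact: zerow.
  + rewrite -root_eq !rootw //; case: (rep w l i) (rep w l j) => [r1|] [r2|] //.
      by apply/eqP/eqP => [/L_inj ->|[->]].
  + rewrite timew endw => tl le; have ni : i != seg_end rho i.
      by apply: contraTneq tl => E; rewrite -leqNgt {1}E letter_time_id.
    have ke : letter_time rho i != seg_end rho (letter_time rho i).
      by rewrite letter_time_end -val_eqE ltn_eqF // letter_time_lt.
    have := G2 _ ke; rewrite letter_time_end => s2.
    have le2 : (F (letter_time rho i).+1 <= F l)%O by apply: leF.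
    rewrite /linked wend wE (sp_le_sub le2 s2) /=.
    case: (boolP (same (F l) _ _)) => //= nz.
    rewrite -(sp_le_sg le2 s2 nz) !ffunE seg_endK eqxx ni /= letter_time_end.
    by rewrite addbF.
- by move=> i; rewrite endw ffunE => ->; rewrite eqxx.
move=> i i0; apply/eqP => ei.
(* A first segment of length one would make the zero block of [F 1] have size 2, which [PiD]
   excludes. *)
have [inB _ _ _] := flF; have := inB 1 ltac:(lia); rewrite in_PiD => /eqP; apply.
have -> : [set a | same (F 1) ord0 a] = [set ord0; L w i].
  apply/setP => a; rewrite !inE; case: (letter_cases w a) => [->|[j ->]].
    by rewrite same_refl eqxx.
  rewrite zerow ?rep_None; last by lia.
  rewrite -val_eqE /= (inj_eq (@L_inj n w)) ltnS leqn0.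
  apply/eqP/eqP => [ej|->]; last by rewrite ei.
  by apply: val_inj; have := seg_end_ge w j; rewrite /= ej i0 leqn0 => /eqP.
by rewrite cards2.
Qed.

End GoodFlags.

(** * Cycles are determined by the flags of the basis *)

Section Vanishing.
Variable n : nat.
Hypothesis n_ge2 : 2 <= n.
Implicit Types (p q : signed_partition n) (w : 'S_n) (e : {ffun 'I_n -> bool}).
Implicit Types (S : {set 'I_n}) (i j c : 'I_n).

Notation L w i := (lift ord0 (w i)).
Notation flagD := (flag (PiD n) n (bot n) (top n)).

Lemma letter_time_ge w i : seg_start w i <= letter_time w i.
Proof. by rewrite -(seg_start_eq (letter_time_end w i)) seg_start_le. Qed.

Lemma negate_firstE e i : 0 < i -> negate_first e i = e i.
Proof. by rewrite ffunE lt0n => /negbTE->. Qed.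

Lemma facet_ext d (T : finPOrderType d) (F G : nat -> T) :
  (forall k, k <= n -> F k = G k) -> facet n F = facet n G.
Proof. by move=> E; apply: eq_imset => k; apply/E/ltnW. Qed.

(** * The interval where the first segment enters the zero block *)

Section FirstSegment.
Variables (w : 'S_n) (z b : 'I_n).
Hypotheses (z0 : z = 0 :> nat) (bE : b = seg_end w z) (b_gt0 : 0 < b).

Lemma first_seg_end i : i <= b -> seg_end w i = b.
Proof. by move=> ib; rewrite bE; apply: seg_end_eq; rewrite ?z0 -?bE. Qed.

Lemma first_seg_start i : i <= b -> seg_start w i = z.
Proof.
move=> /first_seg_end E; apply/val_inj/eqP; rewrite /= z0 -leqn0 -z0.
by apply: (proj2 (seg_startP w i)); rewrite E bE.
Qed.

Lemma first_seg_time i : i < b -> letter_time w i = b - i.+1 :> nat.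
Proof.
move=> ib; rewrite letter_timeE first_seg_end ?(ltnW ib) //.
  by rewrite first_seg_start ?(ltnW ib) // z0.
by rewrite -val_eqE ltn_eqF.
Qed.

Lemma late_rep k i : b < i -> k <= b.+1 -> rep w k i = Some i.
Proof.
move=> bi kb; rewrite /rep (leq_trans kb) //.
by apply: leq_trans (letter_time_ge w i); rewrite {1}bE; apply: seg_next; rewrite -bE.
Qed.

Lemma early_rep i : i <= b -> rep w b i = Some b.
Proof.
move=> ib; rewrite /rep first_seg_end // leqnn.
case: leqP => // bi; congr Some; apply/val_inj/eqP; rewrite eqn_leq ib leqNgt.
by apply/negP => lib; move: bi; rewrite first_seg_time //; lia.
Qed.

(** At the lower end the first segment, apart from its first letter, is one block; at the upper end
    the segment is in the zero block. With [w b] kept out of the zero block, only the first letter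
    can move: it joins that block with one of two relative signs. *)
Lemma first_seg_split e q : q \in PiD n ->
  (mflag w e b.-1 < q)%O -> (q < mflag w e b.+1)%O -> ~~ same q ord0 (L w b) ->
  q = mflag w e b \/ q = mflag w (negate_first e) b.
Proof.
move=> qD lq ql nzb.
have lq' := ltW lq; have ql' := ltW ql.
have tail i j : b < j -> same q (L w i) (L w j) -> i = j.
  move=> bj /(sp_le_sub ql'); rewrite mflag_same (late_rep bj) //.
  case: (leqP i b) => ib; last by rewrite late_rep // => /eqP[].
  by rewrite /rep first_seg_end // ltnn leqNgt ltnS (leq_trans (letter_time_le w i)) ?first_seg_end.
have tail0 j : b < j -> ~~ same q ord0 (L w j).
  by move=> bj; apply/negP => /(sp_le_sub ql'); rewrite mflag_zero late_rep.
have mid i : 0 < i -> i <= b -> linked q w e i b.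
  move=> i0; rewrite leq_eqVlt => /predU1P[/val_inj->|ib]; first exact: linked_refl.
  apply: (linked_le lq'); have := @mflag_linked_end n w e b.-1 i.
  rewrite first_seg_end ?(ltnW ib) // first_seg_time //; apply; lia.
have nzmid i : 0 < i -> i <= b -> ~~ same q ord0 (L w i).
  by move=> i0 ib; have /andP[s _] := mid i i0 ib; rewrite (same_congr_r _ s).
have zE i : (i : nat) = 0 -> i = z by move=> i0; apply: val_inj; rewrite /= i0 z0.
(* The first letter alone in the zero block with 0 would give the forbidden size 2. *)
have nzz : ~~ same q ord0 (L w z).
  apply/negP => zz; move: qD; rewrite in_PiD => /eqP; apply.
  rewrite (_ : [set a | _] = [set ord0; L w z]) ?cards2 //.
  apply/setP => a; rewrite !inE; case: (letter_cases w a) => [->|[i ->]].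
    by rewrite same_refl eqxx.
  rewrite -val_eqE /= (inj_eq (@L_inj n w)).
  case: (posnP i) => [/zE->|i0]; first by rewrite zz eqxx.
  rewrite -val_eqE /= z0 eqn0Ngt i0 /=; apply/negbTE.
  by case: (leqP i b) => ib; [apply: nzmid|apply: tail0].
have nz i : ~~ same q ord0 (L w i).
  case: (posnP i) => [/zE->//|i0].
  by case: (leqP i b) => ib; [apply: nzmid|apply: tail0].
(* Otherwise nothing has been merged and [q] is the lower end of the interval. *)
have szb : same q (L w z) (L w b).
  apply: contraT => nzb'; suff E : mflag w e b.-1 = q by move: lq; rewrite E ltxx.
  have S i j : same q (L w i) (L w j) -> same (mflag w e b.-1) (L w i) (L w j).
    case: (leqP j b) => jb; last by move=> /(tail _ _ jb)->; apply: same_refl.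
    case: (leqP i b) => ib; last by rewrite same_sym => /(tail _ _ ib)->; apply: same_refl.
    have base (k : 'I_n) : 0 < k -> k <= b -> linked (mflag w e b.-1) w e k b.
      move=> k0; rewrite leq_eqVlt => /predU1P[/val_inj->|kb]; first exact: linked_refl.
      have := @mflag_linked_end n w e b.-1 k.
      rewrite first_seg_end ?(ltnW kb) // first_seg_time //; apply; lia.
    case: (posnP i) => [/zE->|i0]; case: (posnP j) => [/zE->|j0].
    - by rewrite !same_refl.
    - by have /andP[s _] := mid j j0 jb; rewrite (same_congr_r _ s) (negbTE nzb').
    - by have /andP[s _] := mid i i0 ib; rewrite (same_congr _ s) same_sym (negbTE nzb').
    - have /andP[s1 _] := base i i0 ib; have /andP[s2 _] := base j j0 jb.
      by rewrite (same_congr _ s1) (same_congr_r _ s2) same_refl.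
  have nz' i : ~~ same (mflag w e b.-1) ord0 (L w i).
    by apply: contra (nz i); apply: sp_le_sub.
  apply: sp_ext => a a'.
    case: (letter_cases w a) => [->|[i ->]]; case: (letter_cases w a') => [->|[j ->]].
    - by rewrite !same_refl.
    - by rewrite (negbTE (nz j)) (negbTE (nz' j)).
    - by rewrite !(same_sym _ _ ord0) (negbTE (nz i)) (negbTE (nz' i)).
    - by apply/idP/idP => [|/S//]; apply: sp_le_sub.
  move=> saa nza; apply: sp_le_sg saa _ => //.
  by case: (letter_cases w a) nza => [->|[i ->]] //; rewrite same_refl.
have ext e' : (forall i, 0 < i -> e' i = e i) -> linked q w e' z b -> q = mflag w e' b.
  move=> ee' lz; apply: mflag_ext => [i|i j|i].
  - rewrite (negbTE (nz i)) rep_None; case: (leqP i b) => ib.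
      by rewrite first_seg_end // ltnn.
    by symmetry; apply/negbTE; rewrite -leqNgt; apply: leq_trans (ltnW ib) (seg_end_ge w i).
  - have sb (k : 'I_n) : k <= b -> same q (L w k) (L w b).
      case: (posnP k) => [/zE->//|k0 kb].
      by have /andP[] := mid k k0 kb.
    case: (leqP i b) => ib; case: (leqP j b) => jb.
    + by rewrite !early_rep // eqxx (same_congr _ (sb i ib)) same_sym sb.
    + rewrite (early_rep ib) (late_rep jb) //; apply/idP/eqP => [/(tail _ _ jb) E|[E]].
        by move: ib; rewrite E leqNgt jb.
      by move: jb; rewrite -E ltnn.
    + rewrite (early_rep jb) (late_rep ib) //; apply/idP/eqP => [|[E]].
        by rewrite same_sym => /(tail _ _ ib) E; move: jb; rewrite E leqNgt ib.
      by move: ib; rewrite E ltnn.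
    + rewrite !late_rep //; apply/idP/eqP => [/(tail _ _ jb)->//|[->]].
      exact: same_refl.
  - move=> tb be; have ib : i <= b.
      rewrite leqNgt; apply/negP => bi.
      have h : b < seg_start w i by rewrite {1}bE; apply: seg_next; rewrite -bE.
      by have := leq_trans h (letter_time_ge w i); rewrite ltnNge ltnW.
    rewrite first_seg_end //; case: (posnP i) => [/zE->//|i0].
    by have := mid i i0 ib; rewrite /linked !ee'.
case: (boolP (linked q w e z b)) => [lz|nlz]; [left|right]; first exact: ext.
apply: ext => [i i0|]; first by rewrite negate_firstE.
move: nlz; rewrite /linked szb (negbTE nzz) /= (negate_firstE _ b_gt0) ffunE z0 eqxx.
by case: (_ (+) _) (e z) (e b) => [] [] [].
Qed.

End FirstSegment.

Lemma nonzero_exists p : rank p < n -> exists a, ~~ same p ord0 a.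
Proof.
move=> rp; apply/existsP; rewrite -negb_forall; apply: contraL rp => /forallP z.
suff E : roots p = [set ord0] by rewrite /rank E cards1 subn1 ltnn.
apply/setP => a; rewrite !inE; apply/eqP/eqP => [<-|->]; last exact: root0.
by rewrite /root z.
Qed.

Lemma flagD_rank F k : flagD F -> k <= n -> rank (F k) = k.
Proof. exact: (flag_rk (graded_PiD n_ge2)). Qed.

Lemma flagD_nonzero F k : flagD F -> k < n -> exists a, ~~ same (F k) ord0 a.
Proof. by move=> flF kn; apply: nonzero_exists; rewrite flagD_rank // ltnW. Qed.

Lemma touched_zero p q : ~~ same p ord0 (umax p) -> same q ord0 (umax p) ->
  ~~ untouched p q.
Proof.
move=> nz zq; rewrite negb_forall; apply/existsP; exists ord0.
by rewrite negb_imply ![same _ _ ord0]same_sym zq.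
Qed.

Lemma umax_ord_max p : ~~ same p ord0 ord_max -> umax p = ord_max.
Proof.
move=> nz; have [_ mx] := umaxP nz; apply/val_inj/eqP.
by rewrite eqn_leq mx // andbT -ltnS ltn_ord.
Qed.

(** * Vanishing of a cycle that is zero on the basis flags *)

Section PeelD.
Variable z : {ffun {set signed_partition n} -> int}.
Hypothesis z_chain : is_chain (proper_part (PiD n)) n.-1 z.
Hypothesis z_cycle : boundary z = 0%R.

Lemma peelD (P : (nat -> signed_partition n) -> Prop) (i0 : nat) : i0 <= n ->
  (forall F (j : nat) q, i0 < j -> P F -> P (update F j q)) ->
  (forall F, flagD F -> P F -> (forall k, k < n -> good F k) -> z (facet n F) = 0%R) ->
  forall F, flagD F -> P F -> (forall k, k < i0 -> good F k) -> z (facet n F) = 0%R.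
Proof.
move=> i0n PU Hgood F flF PF gF; apply/eqP; rewrite -dvd0z.
refine (@peel _ _ _ _ _ _ _ (graded_PiD n_ge2) z z_chain z_cycle 0%R
  (fun _ => @untouched n) P i0 i0n _ _ PU _ F flF PF gF).
- move=> G k flG kn; have [a nza] := flagD_nonzero flG kn.
  by have [nzu _] := umaxP nza; apply: touched_zero => //; apply: same_top.
- move=> G k j q flG flq kj _ bj bq gj.
  have [a nza] := flagD_nonzero flG (ltn_trans (proj1 (andP kj)) (proj2 (andP kj))).
  have [lkj jn] := andP kj.
  have Ek : update G j q k = G k by rewrite /update ltn_eqF.
  have Ej : update G j q j = q by rewrite /update eqxx.
  have Ej1 : update G j q j.+1 = G j.+1 by rewrite /update gtn_eqF.
  have rj1 : rank (G j.+1) = j.+1 by rewrite flagD_rank.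
  have rj : rank (G j) = j by rewrite flagD_rank // ltnW.
  have rq : rank q = j by rewrite -{1}Ej flagD_rank // ltnW.
  apply: (@untouched_uniq _ (G k) q (G j) (G j.+1) a nza) => //.
  + by rewrite -Ek -{2}Ej; apply: (flag_le flq); apply: ltnW.
  + by apply: (flag_le flG); apply: ltnW.
  + by rewrite -Ej1 -{1}Ej; apply: (flag_le flq).
  + by apply: (flag_le flG).
  + by rewrite rj1 rq.
  + by rewrite rj1 rj.
- by move=> G flG PG gG; rewrite dvd0z; apply/eqP/Hgood.
Qed.

Hypothesis z_basis : forall x : Dn n, basis_index x -> z (facet n (mflag x.1 x.2)) = 0%R.

Lemma z_basis_even w e : ~~ odd #|[set i | e i]| ->
  (forall i, seg_end w i = i -> e i = false) ->
  (forall i, i = 0 :> nat -> seg_end w i != i) -> z (facet n (mflag w e)) = 0%R.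
Proof.
move=> ev eF w0; apply: (z_basis (x := DnElt (Dn_pair := (w, e)) ev)).
apply/andP; split; apply/forallP => i /=; apply/implyP.
  move=> /eqP i0; apply: contra (w0 i i0) => /eqP wi; apply/eqP/seg_end_uniq => // j _.
  by rewrite wi -ltnS prednK ?ltn_ord //; apply: leq_ltn_trans (ltn_ord i).
by rewrite rtl_maxE => /eqP /eF ->.
Qed.

Lemma odd_negate_first e : odd #|[set i | e i]| -> ~~ odd #|[set i | negate_first e i]|.
Proof.
move=> od; have lt0 : 0 < n by apply: ltnW.
set z0 : 'I_n := Ordinal lt0.
have E f : #|[set i | f i]| = f z0 + #|[set i | f i] :\ z0| :> nat.
  by rewrite (cardsD1 z0) inE.
rewrite E; move: od; rewrite E !oddD ffunE eqxx !oddb.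
have -> : [set i | negate_first e i] :\ z0 = [set i | e i] :\ z0.
  apply/setP => i; rewrite !inE; have [//|ne /=] := eqVneq i z0.
  by rewrite negate_firstE // lt0n; apply: contra ne => /eqP i0; apply/eqP/val_inj.
by case: (e z0); case: (odd _).
Qed.

(** Before step [seg_end w z0] the first letter is a singleton, and afterwards it lies in the zero
    block; its sign is visible only in between. *)
Lemma mflag_negate_first w e (z0 : 'I_n) (k : nat) : z0 = 0 :> nat -> 0 < seg_end w z0 ->
  k != seg_end w z0 -> mflag w e k = mflag w (negate_first e) k.
Proof.
move=> z00 b0 kb; apply: mflag_ext => [i|i j|i tk ke].
- exact: mflag_zero.
- exact: mflag_same.
have := mflag_linked_end e tk ke; case: (posnP i) => [i0|i0].
  have E : i = z0 by apply: val_inj; rewrite /= i0 z00.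
  subst i; have zb : z0 < seg_end w z0 by rewrite z00.
  by move: tk kb ke; rewrite (first_seg_time z00 erefl zb) z00; lia.
by rewrite /linked !negate_firstE // (leq_trans i0 (seg_end_ge w i)).
Qed.

(* Flags in which the letter [n] enters the zero block no later than step [t].
   The relation through the face omitting the step before pairs the two signs of
   the first letter and otherwise only involves flags in which [n] enters the
   zero block one step earlier. *)
Lemma vanish_zero_at t : t <= n -> forall F, flagD F -> (forall k, k < t -> good F k) ->
  same (F t) ord0 ord_max -> z (facet n F) = 0%R.
Proof.
elim: t => [|t IH] tn F flF gF zF.
  have [_ _ F0 _] := flF; move: zF; rewrite F0.
  case: (letter_cases 1%g (ord_max : 'I_n.+1)) => [/(congr1 val) /= E|[i ->]].
    by exfalso; clear -n_ge2 E; lia.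
  by rewrite same_split0 => /forall_inP /(_ i (in_setT i)); rewrite ltnn.
have [zt|nzt] := boolP (same (F t) ord0 ord_max).
  by apply: IH (ltnW tn) _ flF _ zt => k kt; apply: gF; apply: ltnW.
(* This pins the entry of the largest letter to step [t] and survives every change above index
   [t.+1], so all steps may be assumed good. *)
pose P (G : nat -> signed_partition n) := same (G t.+1) ord0 ord_max /\ ~~ same (G t) ord0 ord_max.
apply: (peelD (P := P) (i0 := t.+1)) flF (conj zF nzt) gF => //.
  move=> G j q tj [h1 h2]; rewrite /P /update !ifN //.
    by rewrite neq_ltn (ltn_trans _ tj).
  by rewrite neq_ltn tj.
move=> {F zF nzt} F flF [zF nzF] gF.
have [w [e [FE eF w0]]] := good_flag_mflag n_ge2 flF gF.
have lt0 : 0 < n by apply: ltnW.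
pose z0 : 'I_n := Ordinal lt0; pose b := seg_end w z0.
have b0 : 0 < b.
  by rewrite lt0n; apply: contra (w0 z0 erefl) => /eqP E; apply/eqP/val_inj.
have Nb : ord_max = L w b.
  case: (letter_cases w (ord_max : 'I_n.+1)) => [/(congr1 val) /= E|[i Ei]].
    by exfalso; clear -n_ge2 E; lia.
  rewrite Ei /b; congr (L w _); apply/esym/seg_end_uniq => // j _.
  by have := congr1 val Ei; rewrite /= /bump /= add1n => E; rewrite -ltnS -E ltn_ord.
have zE k : k <= n -> same (F k) ord0 ord_max = (b < k).
  by move=> kn; rewrite FE // Nb mflag_zero rep_None seg_endK.
have bt : b = t :> nat.
  move: zF nzF; rewrite (zE _ tn) (zE _ (ltnW tn)) -leqNgt ltnS => h1 h2.
  by apply/eqP; rewrite eqn_leq h1.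
have facetF G : (forall k, k <= n -> G k = mflag w e k) -> facet n G = facet n (mflag w e).
  exact: facet_ext.
(* With an even number of bars the flag is one of the basis; otherwise negating the first sign makes
   the number even, and the relation at [b] compares the two. *)
have [od|ev] := boolP (odd #|[set i | e i]|); last first.
  by rewrite (facetF F FE); apply: z_basis_even.
have bn : 0 < b < n by rewrite b0 ltn_ord.
have := flag_link (graded_PiD n_ge2) z_chain z_cycle flF bn.
have [inB ltF _ _] := flF.
have FbP : (F b \in PiD n) && (F b.-1 < F b < F b.+1)%O.
  rewrite inB ?(ltnW (ltn_ord b)) //= ltF // andbT.
  by have := ltF b.-1; rewrite prednK //; apply; apply: ltnW.
rewrite (bigD1 (F b)) //= big1 ?addr0; last first.
  move=> q /andP[/andP[qD lq] qF]; have flq := flag_update (graded_PiD n_ge2) flF bn qD lq.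
  have qb : update F b q b = q by rewrite /update eqxx.
  (* In the first case induction applies: the only new step to check is the one into [q], which is
     good because it moves the largest letter into the zero block. *)
  have [zq|nzq] := boolP (same q ord0 ord_max).
    apply: (IH (ltnW tn) _ flq); last by rewrite -bt qb.
    move=> k kt; have [Ek|nk] := eqVneq k.+1 (b : nat).
      rewrite /good Ek qb /update ltn_eqF; last by rewrite -Ek.
      have nzk : ~~ same (F k) ord0 ord_max.
        by rewrite zE -?leqNgt -?Ek // ltnW // Ek ltnW.
      have Eu := umax_ord_max nzk.
      by apply: touched_zero; rewrite Eu.
    have kb : k < b by rewrite bt.
    rewrite /good /update ltn_eqF // ifN //; apply: gF.
    exact: ltn_trans kb (ltn_ord b).
  have [lq1 lq2] := andP lq.
  have b1n : b.-1 <= n by apply: leq_trans (leq_pred _) (ltnW (ltn_ord b)).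
  rewrite FE // in lq1; rewrite FE // in lq2; rewrite Nb in nzq.
  (* In the second case only the flag with the opposite first sign is left. *)
  have [E|E] := first_seg_split (erefl : z0 = 0 :> nat) erefl b0 qD lq1 lq2 nzq.
    by move: qF; rewrite E FE ?eqxx // ltnW.
  rewrite (@facet_ext _ _ _ (mflag w (negate_first e))).
    apply: z_basis_even => //; first exact: odd_negate_first.
    move=> i ei; rewrite negate_firstE ?eF //.
    by rewrite lt0n; apply/eqP => i0; have := w0 i i0; rewrite ei eqxx.
  move=> k kn; rewrite /update; case: eqP => [->//|/eqP nk].
  by rewrite FE //; apply: (@mflag_negate_first w e z0).
move=> <-; congr (z _); apply: facet_ext => k _; rewrite /update.
by case: eqP => // ->.
Qed.

Lemma cycle_vanish : z = 0%R.
Proof.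
have Z F : flagD F -> z (facet n F) = 0%R.
  move=> flF; apply: (peelD (P := fun _ => True) (i0 := 0)) flF _ _ => // G flG _ gG.
  apply: (vanish_zero_at (leqnn n) flG) => //.
  by have [_ _ _ ->] := flG; apply: same_top.
apply/ffunP => A; rewrite [RHS]ffunE; apply/eqP/negPn/negP => nz.
have [F flF E] := chain_facet (graded_PiD n_ge2) z_chain nz.
by move: nz; rewrite E Z.
Qed.

End PeelD.
End Vanishing.

(** * The Boolean subposets *)

Section BooleanSubposet.
Variable n : nat.
Hypothesis n_ge2 : 2 <= n.
Implicit Types (p q : signed_partition n) (w : 'S_n) (e f : {ffun 'I_n -> bool}).
Implicit Types (S : {set 'I_n}) (i j c : 'I_n).

Notation L w i := (lift ord0 (w i)).

Let z0 : 'I_n := Ordinal (ltnW n_ge2).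
Let z1 : 'I_n := Ordinal n_ge2.

Lemma negate_firstK : involutive (@negate_first n).
Proof. by move=> e; apply/ffunP => i; rewrite !ffunE addbA addbb. Qed.

(* The simple relations: adjacent letters, and for index [0] the first two
   letters with the opposite relative sign. *)
Definition simples w e p : {set 'I_n} :=
  [set i : 'I_n | if (i : nat) == 0 then linked p w (negate_first e) z0 z1
           else linked p w e (ord_pred i) i].

Lemma ord_predE i : 0 < i -> ord_pred i = i.-1 :> nat.
Proof.
move=> i0 /=; have -> : (i + n).-1 = i.-1 + n by lia.
by rewrite modnDr modn_small // (leq_ltn_trans (leq_pred i)).
Qed.

Lemma simples_mono w e p q : (p <= q)%O -> simples w e p \subset simples w e q.
Proof.
by move=> pq; apply/subsetP => i; rewrite !inE; case: ifP => _; apply: linked_le.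
Qed.

Lemma linked_negate w e p i j : 0 < i -> 0 < j ->
  linked p w (negate_first e) i j = linked p w e i j.
Proof. by move=> i0 j0; rewrite /linked !negate_firstE. Qed.

(** Two letters linked with both relative signs can share no block other than the zero block. *)
Lemma linked_both p w e : linked p w e z0 z1 -> linked p w (negate_first e) z0 z1 ->
  same p ord0 (L w z0).
Proof.
rewrite /linked => /andP[-> /=] h; rewrite [negate_first e z1]negate_firstE // ffunE /=.
by case: (same p _ _) h => //= /eqP ->; case: (e z0); case: (e z1).
Qed.

Lemma zero_linked p w e : same p ord0 (L w z0) -> same p ord0 (L w z1) ->
  linked p w e z0 z1.
Proof. by move=> h0 h1; rewrite /linked h0 andbT -(same_congr _ h0). Qed.

Lemma admissible_zero w e S i : admissible S -> z0 \notin S -> i <= 1 ->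
  same (splitting w e S) ord0 (L w i).
Proof.
move=> /forall_inP adm z0S i1; rewrite same_split0; apply/forall_inP => c cS.
have pos d : d \in S -> 0 < d.
  by move=> dS; rewrite lt0n; apply: contraNneq z0S => d0; rewrite (_ : z0 = d) //; apply: val_inj.
apply: leq_ltn_trans i1 _; rewrite ltn_neqAle pos // andbT eq_sym.
apply: contraT; rewrite negbK => /eqP c1; have /implyP h := adm c cS.
by have := h _; rewrite c1; apply; apply/forall_inP => d dS; apply: pos.
Qed.

(** This is the isomorphism with the Boolean lattice, up to complement. Admissibility settles index
    0: without a cut at 0, the first two letters are both in the zero block and thus linked with
    either sign. *)
Lemma simples_split w e S : admissible S -> simples w e (splitting w e S) = ~: S.
Proof.
move=> adm; apply/setP => i; rewrite !inE; case: (posnP i) => [i0|i0].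
  have -> : i = z0 by apply: val_inj.
  have [zS|zS] /= := boolP (z0 \in S); last by apply: zero_linked; apply: admissible_zero.
  have nz : ~~ same (splitting w e S) ord0 (L w z0).
    by rewrite same_split0; apply/forall_inP => /(_ _ zS).
  apply/negP => lk; have := lk; rewrite /linked => /andP[s01 _].
  have lk' : linked (splitting w e S) w e z0 z1.
    by rewrite linked_split -(same_split w e).
  by rewrite (linked_both lk' lk) in nz.
rewrite linked_split; apply/forall_inP/idP => [h|iS c cS].
  by apply/negP => iS; have := h i iS; rewrite ord_predE //; lia.
rewrite ord_predE //.
by have : c != i :> nat by [apply: contraNneq iS => /val_inj <-]; lia.
Qed.

(** Negating the first sign exchanges the two relations on the first pair of letters, so both kinds
    of splittings can be treated alike. *)
Lemma simples_negate w e p :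
  simples w (negate_first e) p = tperm z0 z1 @^-1: simples w e p.
Proof.
apply/setP => i; rewrite !inE; case: tpermP => [->|->|ni0 ni1] /=.
- rewrite negate_firstK; congr linked; apply: ord_inj.
  by rewrite ord_predE.
- by congr linked; apply: ord_inj; rewrite ord_predE.
have i0 : 0 < i by rewrite lt0n; apply/eqP => E; apply/ni0/val_inj.
have i1 : i.-1 != 0 by apply/eqP => E; apply/ni1/val_inj; rewrite /= -(prednK i0) E.
by rewrite eqn0Ngt i0 /= linked_negate // ord_predE // lt0n.
Qed.

Lemma card_simples_negate w e p : #|simples w (negate_first e) p| = #|simples w e p|.
Proof. by rewrite simples_negate card_preimset //; apply: perm_inj. Qed.

Lemma simples_negate_sub w e p q : simples w e p \subset simples w e q ->
  simples w (negate_first e) p \subset simples w (negate_first e) q.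
Proof.
by rewrite !simples_negate; apply: preimsetS.
Qed.

Lemma split_le_simples w e S q : admissible S ->
  simples w e (splitting w e S) \subset simples w e q -> (splitting w e S <= q)%O.
Proof.
move=> adm; rewrite simples_split // => /subsetP sub.
have adj i : i \notin S -> 0 < i -> linked q w e (ord_pred i) i.
  by move=> iS i0; have := sub i; rewrite !inE iS eqn0Ngt i0 => /(_ isT).
apply: split_le => [i j ij jS|i i0 iS].
  have -> : i = ord_pred j by apply: ord_inj; rewrite ord_predE ij.
  by apply: adj; rewrite // ij.
have E : i = z0 by apply: val_inj; rewrite /= i0.
subst i; apply: (@linked_both q w e).
  have -> : z0 = ord_pred z1 by apply: ord_inj; rewrite ord_predE.
  apply: adj => //; apply/negP => z1S; have := admissible_zero w e adm iS (leqnn 1 : z1 <= 1).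
  by rewrite same_split0 => /forall_inP /(_ z1 z1S); rewrite ltnn.
by have := sub z0; rewrite !inE iS => /(_ isT).
Qed.

Lemma tPiP w e p : p \in tPi w e -> exists S, admissible S /\
  (p = splitting w e S \/ p = splitting w (negate_first e) S).
Proof.
rewrite inE => /andP[_ /existsP[S /andP[adm h]]]; exists S; split=> //.
by case/orP: h => /eqP->; [left|right].
Qed.

Lemma splitting_tPi w e S : admissible S -> splitting w e S \in tPi w e.
Proof.
move=> adm; rewrite inE admissible_PiD //=; apply/existsP; exists S.
by rewrite adm eqxx.
Qed.

Lemma le_simples w e p q : p \in tPi w e ->
  simples w e p \subset simples w e q -> (p <= q)%O.
Proof.
case/tPiP=> S [adm [->|->]]; first exact: split_le_simples.
by move/simples_negate_sub; apply: split_le_simples.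
Qed.

Lemma card_simples w e p : p \in tPi w e -> #|simples w e p| = rank p.
Proof.
case/tPiP=> S [adm [->|->]]; last rewrite -card_simples_negate.
all: by rewrite simples_split // cardsCs setCK card_ord rank_split.
Qed.

Lemma graded_tPi w e : graded (tPi w e) n (@rank n) (bot n) (top n).
Proof.
split=> //; [exact: rank_lt| | |exact: bot_le|exact: le_top| |].
- by rewrite -(splitT w e) splitting_tPi //; apply: admissible_setT.
- by rewrite -(split_set0 w e) splitting_tPi //; apply: admissible_set0.
- exact: rank_bot.
- exact: rank_top.
Qed.

Lemma rank_le_eq p q : (p <= q)%O -> rank p = rank q -> p = q.
Proof.
by rewrite le_eqVlt => /predU1P[//|/rank_lt lt E]; rewrite E ltnn in lt.
Qed.

(** * Divisibility of coefficients along a Boolean subposet *)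

Section PeelT.
Variables (w : 'S_n) (e : {ffun 'I_n -> bool}) (z : {ffun {set signed_partition n} -> int}).
Hypothesis w0 : forall i, i = 0 :> nat -> seg_end w i != i.
Hypothesis z_chain : is_chain (proper_part (tPi w e)) n.-1 z.
Hypothesis z_cycle : boundary z = 0%R.

Let flagT := flag (tPi w e) n (bot n) (top n).

Lemma mflag_tPi : flagT (mflag w e).
Proof. by apply: mflag_flag => // S; apply: splitting_tPi. Qed.

(** The exchange argument again: step [k] is bad until [mflag w e k.+1] lies below the flag, and the
    only flag without bad steps is [mflag w e] itself. *)
Lemma dvd_facet (D : int) : (D %| z (facet n (mflag w e)))%Z ->
  forall F, flagT F -> (D %| z (facet n F))%Z.
Proof.
move=> Dm F flF; have flm := mflag_tPi.
pose bad k (_ q : signed_partition n) := ~~ (mflag w e k.+1 <= q)%O.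
have rkF G k : flagT G -> k <= n -> rank (G k) = k by apply: (flag_rk (graded_tPi w e)).
have prefix G k : flagT G -> k <= n -> (forall i : nat, i < k -> ~~ bad i (G i) (G i.+1)) ->
    G k = mflag w e k.
  move=> flG; case: k => [_ _|k kn /(_ k (ltnSn k))].
    by have [_ _ -> _] := flG; have [_ _ -> _] := flm.
  by rewrite negbK => le; symmetry; apply: rank_le_eq; rewrite ?rkF.
apply: (@peel _ _ _ _ _ _ _ (graded_tPi w e) z z_chain z_cycle D bad (fun _ => True) 0) => //.
- by move=> G k _ _; rewrite negbK le_top.
- move=> G k j q flG flq /andP[kj jn] gk; rewrite /bad negbK => nGj nq leGj1.
  have kn : k <= n by apply: ltnW; apply: ltn_trans jn.
  have Gk : G k = mflag w e k by apply: prefix.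
  have uk : update G j q k = G k by rewrite /update ltn_eqF.
  have uj : update G j q j = q by rewrite /update eqxx.
  have uj1 : update G j q j.+1 = G j.+1 by rewrite /update gtn_eqF.
  have [inB _ _ _] := flG; have [inB' _ _ _] := flq; have [inBm _ _ _] := flm.
  have qB : q \in tPi w e by rewrite -uj inB' // ltnW.
  have jB : G j \in tPi w e by rewrite inB // ltnW.
  have j1B : G j.+1 \in tPi w e by rewrite inB.
  have mB l : l <= n -> mflag w e l \in tPi w e by apply: inBm.
  have k1n : k.+1 <= n by apply: ltn_trans jn.
  have subm := simples_mono w e (flag_le flm (leqnSn k) k1n).
  have /eqP/cards1P[a Ea] : #|simples w e (mflag w e k.+1) :\: simples w e (mflag w e k)| = 1.
    rewrite cardsD (setIidPr subm) !card_simples ?mB // !mflag_rank //.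
    by rewrite subSn // subnn.
  have ma : simples w e (mflag w e k.+1) = a |: simples w e (mflag w e k).
    by rewrite -Ea setUC setDE setUIr setUCr setIT; apply/esym/setUidPr.
  (* [a] is the simple relation added by step [k] of [mflag]. An element just below [G j.+1] that
     remains bad must omit exactly [a], which makes it unique. *)
  have main p : p \in tPi w e -> (mflag w e k <= p)%O -> (p <= G j.+1)%O -> rank p = j ->
      ~~ (mflag w e k.+1 <= p)%O -> simples w e p = simples w e (G j.+1) :\ a.
    move=> pB lep ple rp nle.
    have ap : a \notin simples w e p.
      apply: contra nle => ap; apply: (@le_simples w e); first exact: mB.
      rewrite ma subUset sub1set ap; exact: simples_mono.
    have aj : a \in simples w e (G j.+1).
      by apply: (subsetP (simples_mono w e leGj1)); rewrite ma setU11.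
    apply/eqP; rewrite eqEcard; apply/andP; split.
      rewrite subsetD1 ap andbT; exact: simples_mono.
    have := cardsD1 a (simples w e (G j.+1)); rewrite aj !card_simples // rkF // rp.
    by rewrite add1n => -[] <-.
  have Eq : simples w e q = simples w e (G j).
    transitivity (simples w e (G j.+1) :\ a); [|symmetry]; apply: main => //.
    + by rewrite -Gk -uk -{2}uj; apply: (flag_le flq); apply: ltnW.
    + by rewrite -uj1 -{1}uj; apply: (flag_le flq).
    + by rewrite -{1}uj rkF // ltnW.
    + by rewrite -Gk; apply: (flag_le flG); apply: ltnW.
    + by apply: (flag_le flG).
    + by rewrite rkF // ltnW.
  by apply/le_anti; rewrite !(@le_simples w e) // Eq.
- move=> G flG _ gG; rewrite (facet_ext (G := mflag w e)) // => k kn.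
  by apply: prefix => // i ik; apply: gG; apply: leq_trans kn.
Qed.

End PeelT.
End BooleanSubposet.

(** * Unitriangularity *)

Lemma downset_card n (D : {set 'I_n}) :
  (forall i j : 'I_n, i <= j -> j \in D -> i \in D) ->
  forall i, (i \in D) = (i < #|D|).
Proof.
move=> down i; have cardI k : k <= n -> #|[set j : 'I_n | j < k]| = k.
  move=> kn; rewrite -sum1_card (eq_bigl (fun j : 'I_n => j < k)); last by move=> j; rewrite inE.
  rewrite -(big_ord_widen _ (fun=> 1) kn) sum1_card card_ord //.
apply/idP/idP => [iD|].
  rewrite -[X in X <= _](cardI i.+1) //; apply/subset_leq_card/subsetP => j.
  by rewrite inE ltnS => ji; apply: down iD.
apply: contraLR => iD; rewrite -leqNgt; apply: leq_trans (eq_leq (cardI i (ltnW (ltn_ord i)))).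
apply/subset_leq_card/subsetP => j jD; rewrite inE ltnNge.
by apply: contra iD => ij; apply: down jD.
Qed.

Section Triangularity.
Variable n : nat.
Hypothesis n_ge2 : 2 <= n.
Implicit Types (S : {set 'I_n}) (i j q c : 'I_n).

Notation L w i := (lift ord0 (w i)).

Definition suffix_max_sum (w : 'S_n) : nat := \sum_i w (seg_end w i).

Variables (w w' : 'S_n) (e e' : {ffun 'I_n -> bool}).
Hypothesis mflag_in : forall k, 0 < k < n -> mflag w e k \in tPi w' e'.

(** [s i] is the position in [w] of the letter that [w'] has at position [i]. *)
Let s : 'S_n := (w' * w^-1)%g.

Let sE i : w (s i) = w' i.
Proof. by rewrite permM permKV. Qed.

Lemma card_s_lt (a : nat) : a <= n -> #|[set i | s i < a]| = a.
Proof.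
move=> an; have -> : [set i | s i < a] = s @^-1: [set i : 'I_n | i < a].
  by apply/setP => i; rewrite !inE.
rewrite card_preimset; last exact: perm_inj.
rewrite -sum1_card (eq_bigl (fun j : 'I_n => j < a)); last by move=> j; rewrite inE.
by rewrite -(big_ord_widen _ (fun=> 1) an) sum1_card card_ord.
Qed.

Lemma downset_s (a : nat) : a <= n -> (forall i j, i <= j -> s j < a -> s i < a) ->
  forall i, (s i < a) = (i < a).
Proof.
move=> an down i; have := @downset_card n [set i | s i < a] _ i.
rewrite inE card_s_lt //; apply => j k jk; rewrite !inE; exact: down.
Qed.

Lemma seg_start_lt i q : (seg_end w q < seg_start w i) = (q < seg_start w i).
Proof.
apply/idP/idP; first by apply: leq_ltn_trans (seg_end_ge w q).
move=> qi; rewrite ltnNge; apply/negP => h.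
have E : seg_end w (seg_start w i) = seg_end w q by apply: seg_end_eq => //; apply: ltnW.
have := (seg_startP w i).2 q; rewrite -E seg_end_start => /(_ erefl).
by rewrite leqNgt qi.
Qed.

(** At step [seg_start w i] the zero block of the flag consists, besides 0, of the letters of [w]
    before that segment; as a zero block of a splitting of [w'] it is also an initial piece of
    [w']. *)
Lemma s_start i q : (s q < seg_start w i) = (q < seg_start w i).
Proof.
have [->|a0] := posnP (seg_start w i); first by rewrite !ltn0.
apply: downset_s => [|j k jk]; first exact: ltnW.
have an : 0 < seg_start w i < n by rewrite a0 ltn_ord.
have [S [_ mE]] := tPiP (mflag_in an).
rewrite -(seg_start_lt i (s k)) -(seg_start_lt i (s j)) -!rep_None -!(mflag_zero w e) !sE.
by case: mE => ->; rewrite !same_split0 => /forall_inP h; apply/forall_inP => c /h;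
   apply: leq_ltn_trans.
Qed.

Lemma s_end i q : (s q <= seg_end w i) = (q <= seg_end w i).
Proof.
have [bn|bn] := leqP n (seg_end w i).+1.
  have h j : j <= seg_end w i by rewrite -ltnS; apply: leq_trans bn.
  by rewrite (h q) (h (s q)).
have E : seg_start w (Ordinal bn) = (seg_end w i).+1 :> nat.
  apply/eqP; rewrite eqn_leq (seg_start_le w (Ordinal bn)) /=.
  by apply: seg_next => /=.
by rewrite -[LHS]ltnS -[RHS]ltnS -E s_start.
Qed.

(** Passing from [w] to [w'] only permutes letters inside the segments of [w], so a suffix of [w']
    from [i] uses letters of [w] from the start of the segment of [i] on. *)
Lemma suffix_max_le i : w' (seg_end w' i) <= w (seg_end w i).
Proof.
rewrite -sE -(seg_end_start w i); apply: seg_end_max.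
rewrite leqNgt s_start -leqNgt; apply: leq_trans (seg_start_le w i) _.
exact: seg_end_ge.
Qed.

Lemma suffix_max_sum_le : suffix_max_sum w' <= suffix_max_sum w.
Proof. by apply: leq_sum => i _; apply: suffix_max_le. Qed.

Hypothesis sum_eq : suffix_max_sum w' = suffix_max_sum w.

Lemma suffix_max_eq i : w' (seg_end w' i) = w (seg_end w i).
Proof.
apply/val_inj/eqP; rewrite eqn_leq suffix_max_le /= leqNgt; apply/negP => lt.
have := sum_eq; rewrite /suffix_max_sum (bigD1 i) //= [RHS](bigD1 i) //= => E.
have : \sum_(j | j != i) w' (seg_end w' j) <= \sum_(j | j != i) w (seg_end w j).
  by apply: leq_sum => j _; apply: suffix_max_le.
by move/(leq_add lt); rewrite addSn E ltnn.
Qed.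

(** Equal suffix maxima from the segment end [b] place the letter [w b] at or after [b] in [w'];
    preservation of segments places it at or before [b]. *)
Lemma s_fix_end i : s (seg_end w i) = seg_end w i.
Proof.
set b := seg_end w i; have := suffix_max_eq b.
rewrite -sE seg_endK => /perm_inj sq.
have qb : seg_end w' b <= b by rewrite -(s_end i) sq.
suff E : seg_end w' b = b by move: sq; rewrite E.
by apply/val_inj/eqP; rewrite eqn_leq qb seg_end_ge.
Qed.

(** At step [cut_time w i] the block of the segment end [b] occupies the positions from [i] to [b]
    in [w]. It is an interval of [w'] as well, and ends at the fixed position [b], so it starts at
    the same place. *)
Lemma s_nonend i q : i != seg_end w i -> (s q < i) = (q < i).
Proof.
move=> ni; set b := seg_end w i.
have ib : i < b by rewrite ltn_neqAle ni seg_end_ge.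
have ai := seg_start_le w i.
have kE : cut_time w i = seg_start w i + b - i :> nat by [].
have kn : 0 < cut_time w i < n by rewrite ltn_ord kE; lia.
have [S [_ mE]] := tPiP (mflag_in kn).
have sb : s b = b by apply: s_fix_end.
have cls j : same (mflag w e (cut_time w i)) (L w j) (L w b) =
    (i <= j) && (j <= b).
  rewrite mflag_same.
  have -> : rep w (cut_time w i) b = Some b.
    by rewrite /rep -{1}/b letter_time_id ifT // -/b kE; lia.
  apply/eqP/andP => [|[ij jb]].
    rewrite /rep; case: leqP => [_ [->]|tk]; first by rewrite ltnW.
    case: leqP => // ke [Eb]; split; last by rewrite -Eb seg_end_ge.
    have nj : j != seg_end w j.
      by apply: contraTneq tk => E; rewrite -leqNgt {1}E letter_time_id.
    move: tk; rewrite letter_timeE // kE (seg_start_eq (Eb : seg_end w j = seg_end w i)) Eb.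
    have := seg_end_ge w j; rewrite Eb; have : j != b :> nat by rewrite -Eb.
    by clear -ib ai; lia.
  have Ej : seg_end w j = b by apply: seg_end_eq.
  rewrite /rep Ej; case: leqP => [kj|_].
    congr Some; apply/eqP; rewrite -Ej; apply: contraT => nj.
    move: kj; rewrite letter_timeE // kE (seg_start_eq (Ej : seg_end w j = seg_end w i)) Ej.
    by clear -ib ai ij jb; lia.
  by rewrite ifT // kE; clear -ib ai; lia.
apply: downset_s => [|j k jk skj]; first exact: ltnW.
rewrite ltnNge; apply/negP => isj; have skb : s k <= b by apply: ltnW; apply: ltn_trans ib.
have kb : k <= b by rewrite -(s_end i).
have sjb : s j <= b by rewrite s_end; apply: leq_trans kb.
have : same (mflag w e (cut_time w i)) (L w (s j)) (L w (s b)) by rewrite sb cls isj.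
have : ~~ same (mflag w e (cut_time w i)) (L w (s k)) (L w (s b)).
  by rewrite sb cls negb_and -ltnNge skj.
rewrite !sE; case: mE => ->; rewrite !same_split => /negP h /forall_inP h'; apply: h.
all: by apply/forall_inP => c /h'; clear -jk kb; lia.
Qed.

Lemma perm_determined : w' = w.
Proof.
suff sid i : s i = i by apply/permP => i; rewrite -sE sid.
(* So [s] preserves every initial interval of positions and must be the identity. *)
have lt j q : (s q < j) = (q < j).
  have [E|] := eqVneq j (seg_end w j); last exact: s_nonend.
  have := s_end j q; rewrite -E; have sj : s j = j by rewrite E s_fix_end.
  have [->|qj] := eqVneq q j; first by rewrite sj.
  have : s q != j by rewrite -{1}sj (inj_eq perm_inj).
  by rewrite -val_eqE in qj *; move: qj; rewrite -val_eqE /=; lia.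
apply/val_inj/eqP; rewrite eqn_leq; apply/andP; split; rewrite leqNgt.
  by apply/negP; rewrite -lt ltnn.
by rewrite lt ltnn.
Qed.

Hypothesis eF : forall i, seg_end w i = i -> e i = false.
Hypothesis eF' : forall i, seg_end w' i = i -> e' i = false.
Hypothesis even_e : ~~ odd #|[set i | e i]|.
Hypothesis even_e' : ~~ odd #|[set i | e' i]|.

(** At step [seg_end w i] the letter at [i] is linked to its segment end, which is unbarred for both
    sign vectors. This fixes all signs except the first, and parity fixes that one. *)
Lemma sign_determined : e' = e.
Proof.
have ww := perm_determined.
have pos i : 0 < i -> e' i = e i.
  move=> i0; have [E|ni] := eqVneq i (seg_end w i).
    by rewrite eF // eF' // ww.
  set b := seg_end w i; have ib : i < b by rewrite ltn_neqAle ni seg_end_ge.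
  have b0 : 0 < b by apply: leq_ltn_trans ib.
  have bn : 0 < b < n by rewrite b0 ltn_ord.
  have [S [_ mE]] := tPiP (mflag_in bn); rewrite ww in mE.
  have := mflag_linked_end e (letter_time_lt ni) (leqnn b).
  have nz : ~~ same (mflag w e b) ord0 (L w i) by rewrite mflag_zero rep_None ltnn.
  rewrite /linked (negbTE nz) -/b => /andP[sib /eqP].
  have -> : e b = false by apply/eF/seg_endK.
  have e'b : e' b = false by apply: eF'; rewrite ww seg_endK.
  move: sib nz; case: mE => -> sib nz; rewrite sg_split // ?negate_firstE //.
    by rewrite e'b !addbF.
  by rewrite e'b !addbF.
apply/ffunP => i; have [i0|] := posnP i; last exact: pos.
have E (f : {ffun 'I_n -> bool}) : #|[set j | f j]| = f i + #|[set j | f j] :\ i| :> nat.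
  by rewrite (cardsD1 i) inE.
move: even_e even_e'; rewrite !E.
have -> : [set j | e' j] :\ i = [set j | e j] :\ i.
  apply/setP => j; rewrite !inE; have [//|ne /=] := eqVneq j i.
  by rewrite pos // lt0n; apply: contra ne => /eqP j0; apply/eqP/val_inj; rewrite /= j0 i0.
by rewrite !oddD !oddb; case: (e i); case: (e' i); case: (odd _).
Qed.

End Triangularity.

(** * The coefficient matrix and the basis *)

Lemma basis_indexP n (x : Dn n) : 2 <= n -> basis_index x ->
  [/\ forall i : 'I_n, i = 0 :> nat -> seg_end x.1 i != i,
      forall i, seg_end x.1 i = i -> x.2 i = false & ~~ odd #|[set i | x.2 i]|].
Proof.
move=> n_ge2 /andP[/forallP h1 /forallP h2]; split; last by case: x {h1 h2}.
  move=> i i0; have /implyP := h1 i; rewrite i0 eqxx => /(_ isT) wi.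
  apply/eqP => ei; have lt : n.-1 < n by rewrite ltn_predL ltnW.
  have := seg_end_max x.1 (_ : i <= ((x.1)^-1)%g (Ordinal lt)).
  rewrite i0 permKV ei => /(_ isT) /= h.
  by move: wi; rewrite eqn_leq h -ltnS prednK ?ltn_ord // ltnW.
by move=> i ei; apply/negbTE; apply: (implyP (h2 i)); rewrite rtl_maxE ei.
Qed.

Theorem theorem8p4 (n : nat) (hn : (2 <= n)%N)
    (rho : forall x : Dn n, cycles (proper_part (tPi x.1 x.2)) (n - 2))
    (hrho : forall x : Dn n, fundamental_cycle (rho x)) :
  Zbasis (V := homology (proper_part (PiD n)) (n - 2))
    (fun x : {x : Dn n | basis_index x} =>
       homology_class (cycle_incl (proper_partS (tPi_sub _ _)) (rho (sval x)))).
Proof.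
pose X : finType := {x : Dn n | basis_index x}.
pose r (x : X) : cycles (proper_part (PiD n)) (n - 2) :=
  cycle_incl (proper_partS (tPi_sub _ _)) (rho (sval x)).
pose m (x : X) := facet n (mflag (sval x).1 (sval x).2).
have grD := graded_PiD hn.
pose M (x y : X) : int := r x (m y).
pose Phi (x : X) := suffix_max_sum (sval x).1.
have M_unit x : (`|M x x| = 1)%N.
  have grT := graded_tPi hn (sval x).1 (sval x).2.
  have [x0 _ _] := basis_indexP hn (valP x).
  apply: (fundamental_unit grT _ (hrho (sval x))) => D dm F flF.
  exact: (dvd_facet hn x0 (cycle_is_chain grT _) (cycle_boundary _) dm flF).
have M_tri x y : M x y != 0%R -> x != y -> Phi x < Phi y.
  move=> nz xy; have grT := graded_tPi hn (sval x).1 (sval x).2.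
  have [x0 xF xev] := basis_indexP hn (valP x); have [y0 yF yev] := basis_indexP hn (valP y).
  (* A nonzero entry means that [m y] is a chain of the Boolean subposet of [x], which is the
     situation of the triangularity argument. *)
  have /andP[+ _] := implyP (forallP (cycle_is_chain grT (rho (sval x))) (m y)) nz.
  rewrite inE => /andP[/subsetP sub _].
  have inT k : 0 < k < n -> mflag (sval y).1 (sval y).2 k \in tPi (sval x).1 (sval x).2.
    move=> kn; have /sub : mflag (sval y).1 (sval y).2 k \in m y by apply/facetP; exists k.
    by rewrite inE => /andP[].
  rewrite /Phi ltn_neqAle (suffix_max_sum_le inT) andbT; apply: contra xy => /eqP E.
  apply/eqP/val_inj/val_inj; rewrite /= [Dn_pair (sval x)]surjective_pairing.
  rewrite [RHS]surjective_pairing; congr (_, _).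
    exact: perm_determined inT E.
  exact: (sign_determined hn inT E yF xF yev xev).
move=> v; have [z ->] : exists z, v = homology_class z.
  by exists (generic_quotient.repr v); rewrite /homology_class generic_quotient.reprK.
have [a aP] := triangular_surj M_unit M_tri (fun y => z (m y)).
(* By [cycle_vanish] a cycle is determined by its values on the flags [m y], so expanding a class
   amounts to solving a linear system with matrix [M]. *)
have eqP' (a' : {ffun X -> int}) : homology_class z = (\sum_x homology_class (r x) *~ a' x)%R <->
    (forall y, \sum_x a' x * M x y = z (m y))%R.
  rewrite homology_class_sum; split=> [/(homology_class_inj grD) -> y|E].
    by rewrite cycle_sumE.
  congr homology_class; apply/eqP; rewrite -subr_eq0; apply/eqP; apply: val_inj.
  apply: (cycle_vanish hn) => [||x xb].
  - exact: (cycle_is_chain grD).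
  - exact: cycle_boundary.
  - pose y : X := exist _ x xb.
    rewrite -[facet _ _]/(m y) -[\val _]/(cycle_chain z - cycle_chain (\sum_x r x *~ a' x))%R.
    by rewrite ffunE [X in (_ + X)%R]ffunE cycle_sumE E subrr.
exists a; split=> [|a' /eqP' a'P]; first exact/eqP'.
apply/ffunP => x; apply/eqP; rewrite -subr_eq0; apply/eqP.
apply: (triangular_inj M_unit M_tri (a := fun x => a x - a' x)%R) => y.
under eq_bigr do rewrite mulrBl; by rewrite sumrB aP a'P subrr.
Qed.
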